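(* Let $X_1,X_2,\dots$ be i.i.d. Bernoulli random variables with $\Pr\{X_i=1\}=1-\Pr\{X_i=0\}=p\in(0,1)$, let $\gamma$ be a positive integer, let $\mathbf n$ be the random integer satisfying $\sum_{i=1}^{\mathbf n-1}X_i<\gamma=\sum_{i=1}^{\mathbf n}X_i$, and let $\widehat{\boldsymbol p}_\gamma=\frac{\gamma}{\mathbf n}$. Then the following hold. (I) If $\varepsilon>0$, $0<\delta<1$ and $$\gamma>\frac{1+\varepsilon}{(1+\varepsilon)\ln(1+\varepsilon)-\varepsilon}\ln\frac2\delta,$$ then $\Pr\big\{\big|\frac{\widehat{\boldsymbol p}_\gamma-p}{p}\big|<\varepsilon\big\}>1-\delta$ for every $p\in(0,1)$. (II) Suppose $0<\varepsilon<1$, $$0<\delta<\exp\left(-\frac{3\varepsilon^3(4+\varepsilon)+4\varepsilon(3+\varepsilon)\ln2}{4(9-6\varepsilon-2\varepsilon^2)}-\varepsilon\sqrt{\left[\frac{3\varepsilon^2(4+\varepsilon)+4(3+\varepsilon)\ln2}{4(9-6\varepsilon-2\varepsilon^2)}\right]^2+\frac{3(1+\varepsilon)(3+\varepsilon)\ln2}{2(9-6\varepsilon-2\varepsilon^2)}}\right),$$ and $$\gamma>\frac{1+\varepsilon}{(1+\varepsilon)\ln(1+\varepsilon)-\varepsilon}\ln\frac{1+\zeta}{\delta},$$ where $\zeta=2C_{\mathrm{BE}}\sqrt{\frac1m+\frac{z}{m-z-mz}}$ with $m=\frac2{\varepsilon^2}\ln\frac1\delta$ and $z=1+\frac{2\varepsilon}{3+\varepsilon}-\frac{9}{(3+\varepsilon)^2}\frac{\ln\frac1\delta}{\ln\frac2\delta}$.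 Then $\Pr\big\{\big|\frac{\widehat{\boldsymbol p}_\gamma-p}{p}\big|<\varepsilon\big\}>1-\delta$ for every $p\in(0,1)$.
   Context: $C_{\mathrm{BE}}$ denotes the absolute constant in the Berry–Esseen inequality: for i.i.d. $Y_1,Y_2,\dots$ distributed as $Y$ with $\mathbb{E}[Y]=0$, $\mathbb{E}[Y^2]>0$, $\mathbb{E}[|Y|^3]<\infty$, the cdf $F_n$ of $\sum_{i=1}^nY_i/\sqrt{n\mathbb{E}[Y^2]}$ satisfies $|F_n(y)-\Phi(y)|\le\frac{C_{\mathrm{BE}}}{\sqrt n}\frac{\mathbb{E}[|Y|^3]}{\mathbb{E}^{3/2}[Y^2]}$ for all $y,n$, where $\Phi$ is the standard normal cdf. *)

(* Defs.v *)
From HB Require Import structures.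
From mathcomp Require Import all_boot all_order all_algebra.
From mathcomp Require Import all_classical all_reals all_analysis.
Set Implicit Arguments. Unset Strict Implicit. Unset Printing Implicit Defensive.
Import Order.TTheory GRing.Theory Num.Theory.
Import numFieldNormedType.Exports.
Local Open Scope classical_set_scope.
Local Open Scope ring_scope.

Definition mutually_independent d (T : measurableType d) (R : realType)
  (P : probability T R) (X : nat -> {RV P >-> R}) : Prop :=
  forall (J : seq nat) (B : nat -> set R), uniq J ->
    (forall j, j \in J -> measurable (B j)) ->
    P (\bigcap_(j in [set` J]) (X j @^-1` B j)) =
    (\prod_(j <- J) P (X j @^-1` B j))%E.

Definition identically_distributed d (T : measurableType d) (R : realType)
  (P : probability T R) (X : nat -> {RV P >-> R}) : Prop :=
  forall (i : nat) (B : set R), measurable B ->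
    P (X i @^-1` B) = P (X 0 @^-1` B).

Definition iid_seq d (T : measurableType d) (R : realType)
  (P : probability T R) (X : nat -> {RV P >-> R}) : Prop :=
  mutually_independent X /\ identically_distributed X.

Definition bernoulli_rv d (T : measurableType d) (R : realType)
  (P : probability T R) (p : R) (X : {RV P >-> R}) : Prop :=
  P (X @^-1` [set 1]) = p%:E /\ P (X @^-1` [set 0]) = (1 - p)%:E.

Definition Phi (R : realType) (y : R) : R :=
  fine (normal_prob 0 1 `]-oo, y]).

Definition berry_esseen_constant (R : realType) (C : R) : Prop :=
  forall (d : measure_display) (T : measurableType d) (P : probability T R)
         (Y : nat -> {RV P >-> R}),
    iid_seq Y ->
    ('E_P[Y 0%N] = 0)%E ->
    (0 < 'E_P[fun w => (Y 0%N w ^+ 2)%R])%E ->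
    ('E_P[fun w => (`|Y 0%N w| ^+ 3)%R] < +oo)%E ->
    forall (n : nat) (y : R), (0 < n)%N ->
      let s2 := fine ('E_P[fun w => (Y 0%N w ^+ 2)%R])%E in
      let m3 := fine ('E_P[fun w => (`|Y 0%N w| ^+ 3)%R])%E in
      `| fine (P [set w | (\sum_(i < n) Y i w) / Num.sqrt (n%:R * s2) <= y])
         - Phi y |
      <= C / Num.sqrt n%:R * (m3 / (Num.sqrt s2) ^+ 3).

(** The event { |(hat p_gamma - p)/p| < eps }, where n(w) is the (random)
    integer with sum_{i=1}^{n-1} X_i < gamma = sum_{i=1}^{n} X_i
    (X_1, X_2, ... are X 0, X 1, ...), and hat p_gamma = gamma / n. *)
Definition good_event d (T : measurableType d) (R : realType)
  (P : probability T R) (X : nat -> {RV P >-> R}) (gamma : nat) (p eps : R)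
  : set T :=
  [set w | exists n : nat,
      (\sum_(i < n.-1) X i w < gamma%:R) /\
      (\sum_(i < n) X i w = gamma%:R) /\
      `| (gamma%:R / n%:R - p) / p | < eps].

Definition coefA (R : realType) (eps : R) : R :=
  (1 + eps) / ((1 + eps) * ln (1 + eps) - eps).

Definition delta_bound (R : realType) (eps : R) : R :=
  let D := 9 - 6 * eps - 2 * eps ^+ 2 in
  expR (- ((3 * eps ^+ 3 * (4 + eps) + 4 * eps * (3 + eps) * ln 2) / (4 * D))
        - eps * Num.sqrt (((3 * eps ^+ 2 * (4 + eps) + 4 * (3 + eps) * ln 2)
                            / (4 * D)) ^+ 2
                          + (3 * (1 + eps) * (3 + eps) * ln 2) / (2 * D))).

Definition zeta (R : realType) (C eps delta : R) : R :=
  let m := 2 / eps ^+ 2 * ln (1 / delta) in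
  let z := 1 + 2 * eps / (3 + eps)
           - 9 / (3 + eps) ^+ 2 * (ln (1 / delta) / ln (2 / delta)) in
  2 * C * Num.sqrt (1 / m + z / (m - z - m * z)).

(* Main.v *)
(* Both tails of the stopping time are binomial tails: with S_k the sum of the
   first k variables, the stopping time is <= N iff S_N >= gamma, and > N iff
   S_N < gamma.  Since the variables are almost surely 0 or 1, every binomial
   tail is a finite sum over words of N bits.

   Tilting the p-coin by a factor x per head gives Chernoff's bound; with
   x = 1 + eps, resp. 1 - eps (if eps < 1), the tails are at most
   exp (- gamma / coefA eps), which proves (I).

   For (II) each tail is below delta/2.  The condition delta < delta_bound eps
   says exactly that m - z - m z > 0.  If the threshold mean, (1 + eps) p for
   the upper tail and p for the lower tail, is at most z, then under a tilted
   coin of mean about gamma/N the tail is an event of the form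
   "at least (at most) its mean", of probability at most 1/2 + zeta/2 by
   Berry-Esseen at 0.  If it exceeds z, then Massart's inequality
   kl(q,p) >= (q-p)^2 / (2 y (1-y)), y = (2p+q)/3, improves the Chernoff bound
   to delta/2.  Applying Berry-Esseen needs an i.i.d. sequence of tilted coins:
   these are read off the symbolic coding of a uniform point of [0,1]. *)

Require Import Defs.
From HB Require Import structures.
From mathcomp Require Import all_boot all_order all_algebra.
From mathcomp Require Import all_classical all_reals all_analysis.
From mathcomp Require Import measurable_realfun ring lra.
Import Order.TTheory GRing.Theory Num.Theory.
Import numFieldNormedType.Exports.
Local Open Scope classical_set_scope.
Local Open Scope ring_scope.

(** * Real inequalities *)

Lemma is_deriveD_fun {R : realType} (f g : R -> R) (x a b : R) :
  is_derive x 1 f a -> is_derive x 1 g b ->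
  is_derive x 1 (fun y => f y + g y) (a + b).
Proof. by move=> df dg; exact: is_deriveD. Qed.

Lemma is_deriveN_fun {R : realType} (f : R -> R) (x a : R) :
  is_derive x 1 f a -> is_derive x 1 (fun y => - f y) (- a).
Proof. by move=> df; exact: is_deriveN. Qed.

Lemma is_deriveM_fun {R : realType} (f g : R -> R) (x a b : R) :
  is_derive x 1 f a -> is_derive x 1 g b ->
  is_derive x 1 (fun y => f y * g y) (f x * b + g x * a).
Proof. by move=> df dg; exact: is_deriveM. Qed.

Lemma is_deriveX_fun {R : realType} (f : R -> R) (n : nat) (x a : R) :
  is_derive x 1 f a ->
  is_derive x 1 (fun y => f y ^+ n) (n%:R * f x ^+ n.-1 * a).
Proof.
move=> df; have := @is_deriveX R R f n x 1 a df.
by congr (is_derive _ _ _ _); apply/funext => y; rewrite fctE.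
Qed.

Lemma is_deriveV_fun {R : realType} (f : R -> R) (x a : R) :
  f x != 0 -> is_derive x 1 f a ->
  is_derive x 1 (fun y => (f y)^-1) (- (f x) ^- 2 * a).
Proof. by move=> fx df; exact: is_deriveV. Qed.

Lemma is_derive_ln_fun {R : realType} (f : R -> R) (x a : R) :
  0 < f x -> is_derive x 1 f a ->
  is_derive x 1 (fun y => ln (f y)) ((f x)^-1 * a).
Proof. by move=> fx df; apply: is_derive1_comp; exact: is_derive1_ln. Qed.

Lemma is_derive_congr {R : realType} (f : R -> R) (x a b : R) :
  is_derive x 1 f a -> a = b -> is_derive x 1 f b.
Proof. by move=> df <-. Qed.

(* Premises of class [is_derive] must stay out of the reach of typeclass
   resolution, which is very slow on the functions at hand. *)
Ltac derive_step :=
  match goal with |- is_derive ?x ?v ?f ?df =>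
    change (is_derive x v (fun y => f y) df); cbv beta end;
  lazymatch goal with
  | |- is_derive _ _ (fun _ => ?c) _ => exact: is_derive_cst
  | |- is_derive _ _ (fun y => y) _ => exact: is_derive_id
  | |- is_derive _ _ (fun y => _ + _) _ =>
      notypeclasses refine (is_deriveD_fun _ _ _ _ _ _ _)
  | |- is_derive _ _ (fun y => - _) _ =>
      notypeclasses refine (is_deriveN_fun _ _ _ _)
  | |- is_derive _ _ (fun y => _ * _) _ =>
      notypeclasses refine (is_deriveM_fun _ _ _ _ _ _ _)
  | |- is_derive _ _ (fun y => _ ^+ _) _ =>
      notypeclasses refine (is_deriveX_fun _ _ _ _ _)
  | |- is_derive _ _ (fun y => _^-1) _ =>
      notypeclasses refine (is_deriveV_fun _ _ _ _ _)
  | |- is_derive _ _ (fun y => ln _) _ =>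
      notypeclasses refine (is_derive_ln_fun _ _ _ _ _)
  end.

Ltac derive := notypeclasses refine (is_derive_congr _ _ _ _ _ _);
  [repeat derive_step | rewrite /GRing.scale /=].

Lemma subr1_ge_lnV {R : realType} (u : R) : 0 < u -> 1 - u^-1 <= ln u.
Proof.
move=> u0; have := @le_ln1Dx R (u^-1 - 1); rewrite (addrC 1) subrK lnV ?posrE//.
have u'0 : 0 < u^-1 by rewrite invr_gt0.
move/(_ ltac:(lra)); lra.
Qed.

Lemma ln_le_sub1 {R : realType} (u : R) : 0 < u -> ln u <= u - 1.
Proof. by move=> u0; have := @le_ln1Dx R (u - 1) ltac:(lra); rewrite (addrC 1) subrK; lra. Qed.

Lemma derive_ge0_le {R : realType} (f f' : R -> R) (a b : R) : a <= b ->
  (forall x, a <= x <= b -> is_derive x 1 f (f' x)) ->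
  (forall x, a <= x <= b -> 0 <= f' x) -> f a <= f b.
Proof.
move=> ab df f'0.
have dfo x : x \in `]a, b[ -> is_derive x 1 f (f' x).
  by rewrite in_itv/= => /andP[/ltW ax /ltW xb]; apply: df; rewrite ax xb.
apply: (@ger0_derive1_le_cc R f a b) => //.
- by move=> x /dfo [].
- move=> x xab; have [_] := dfo x xab; rewrite derive1E => ->.
  by move: xab; rewrite in_itv/= => /andP[/ltW ax /ltW xb]; apply: f'0; rewrite ax xb.
- apply: continuous_in_subspaceT => x; rewrite inE/= in_itv/= => xab.
  have [dx _] := df x xab.
  exact/differentiable_continuous/derivable1_diffP.
- by rewrite in_itv/= lexx ab.
- by rewrite in_itv/= lexx ab.
Qed.

(** The two sides agree at 1, and their difference has derivative (1 - 1/x)^2 / 2, a square. *)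
Lemma ln_le_mean {R : realType} (u : R) : 1 <= u -> ln u <= (u - u^-1) / 2.
Proof.
move=> u1.
pose f := fun x : R => (x - x^-1) / 2 - ln x.
suff : f 1 <= f u by rewrite /f invr1 ln1; lra.
apply: (@derive_ge0_le R f (fun x => (1 - x^-1) ^+ 2 / 2)) => //.
- move=> x /andP[x1 _]; have x0 : 0 < x by lra.
  have xn0 : x != 0 by rewrite gt_eqF.
  rewrite /f; derive; [lra..|field; lra].
- by move=> x _; rewrite divr_ge0// sqr_ge0.
Qed.

(** For e > 0 this is the reciprocal of [coefA e]: the Chernoff exponent per success that remains
    once p is eliminated. *)
Definition rate {R : realType} (e : R) := ln (1 + e) - e / (1 + e).

Lemma rate_le {R : realType} (e : R) : 0 < e -> rate e <= e ^+ 2 / 2.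
Proof.
move=> e0; have := @ln_le_mean R (1 + e) ltac:(lra); rewrite /rate => h.
have -> : e / (1 + e) = ((1 + e) - (1 + e)^-1) / 2 - e ^+ 2 / 2 / (1 + e).
  by field; lra.
have : e ^+ 2 / 2 / (1 + e) <= e ^+ 2 / 2.
  by rewrite ler_pdivrMr; [nra|lra].
lra.
Qed.


Lemma rate_gt0 {R : realType} (e : R) : 0 < e -> 0 < rate e.
Proof.
move=> e0; have e1 : 0 < 1 + e by lra.
have : - ln (1 + e) != 0 by rewrite oppr_eq0 ln_eq0//; lra.
move=> /expR_gt1Dx; rewrite -lnV ?posrE// lnK ?posrE ?invr_gt0//.
rewrite /rate (_ : e / (1 + e) = 1 - (1 + e)^-1); last by field; lra.
rewrite lnV ?posrE//; lra.
Qed.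

Lemma coefAE {R : realType} (e : R) : 0 < e -> coefA e = (rate e)^-1.
Proof.
move=> e0; rewrite /coefA /rate -[LHS]invrK invf_div; congr _^-1.
by field; lra.
Qed.

(** The right side is the exponent natural to the lower tail, so one rate serves both tails. This is
    [ln_le_mean] at u = (1 + e)/(1 - e). *)
Lemma rate_le_lower {R : realType} (e : R) : 0 < e < 1 ->
  rate e <= e / (1 - e) + ln (1 - e).
Proof.
move=> /andP[e0 e1].
have := @ln_le_mean R ((1 + e) / (1 - e)).
rewrite ler_pdivlMr; last lra.
move=> /(_ ltac:(lra)); rewrite ln_div ?posrE; [|lra|lra].
rewrite invf_div (_ : (_ - _) / 2 = e / (1 - e) + e / (1 + e)).
  rewrite /rate; lra.
by field; apply/andP; split; lra.
Qed.

(** The derivative of the difference has numerator 9 - 3x + 4x^2, which is positive. The bound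
    settles the boundary case (1 + e) p = 1 of [tail_ge_large_mean]. *)
Lemma ln1D_ge {R : realType} (e : R) : 0 < e -> 9 * e / (4 * (3 + e)) <= ln (1 + e).
Proof.
move=> e0.
pose f := fun x : R => ln (1 + x) - 9 * x / (4 * (3 + x)).
suff : f 0 <= f e by rewrite /f addr0 ln1 mulr0 mul0r; lra.
apply: (@derive_ge0_le R f (fun x => (1 + x)^-1 - 27 / (4 * (3 + x) ^+ 2))) => //.
- exact: ltW.
- move=> x /andP[x1 _]; have x0 : 0 < 1 + x by lra.
  have xn0 : 4 * (3 + x) != 0 by lra.
  rewrite /f; derive; [lra..|field]; apply/andP; split; lra.
- move=> x /andP[x0 _].
  rewrite (_ : _ - _ = (9 - 3 * x + 4 * x ^+ 2) / ((1 + x) * (4 * (3 + x) ^+ 2))).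
    rewrite divr_ge0//; first by nra.
    by rewrite mulr_ge0//; nra.
  by field; apply/andP; split; lra.
Qed.

Definition kl {R : realType} (q p : R) : R :=
  q * ln (q / p) + (1 - q) * ln ((1 - q) / (1 - p)).

(* With y = (2p + q)/3 the mean of the density proportional to |q - x| on the
   interval between p and q, this is Jensen's inequality applied to the convex
   function 1/(x(1-x)) in kl(q,p) = \int_p^q (q - x)/(x(1-x)) dx: the tangent
   line at y is integrated exactly. *)
Lemma kl_ge {R : realType} (p q y : R) : 0 < p < 1 -> 0 < q < 1 ->
  y = (2 * p + q) / 3 ->
  (q - p) ^+ 2 / (2 * (y * (1 - y))) <= kl q p.
Proof.
move=> /andP[p0 p1] /andP[q0 q1] yE.
have y0 : 0 < y by rewrite yE; lra.
have y1 : y < 1 by rewrite yE; lra.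
pose s := y * (1 - y).
have s0 : 0 < s by rewrite /s mulr_gt0//; lra.
pose a := s^-1; pose b := (2 * y - 1) / s ^+ 2.
(* The first two terms of [G] have derivative (x - q)/(x(1 - x)); the others subtract the primitive
   of (x - q) times the tangent line at y. The claim becomes G q <= G p. The equation [GE] keeps [G]
   opaque. *)
have [G GE] : exists G : R -> R, G = (fun x => - q * ln x - (1 - q) * ln (1 - x)
   - a * (x - q) ^+ 2 / 2
   - b * ((x - q) ^+ 3 / 3 + (q - y) * (x - q) ^+ 2 / 2)) by eexists.
have [G' G'E] : exists G' : R -> R, G' =
   (fun x => (x - q) * ((x * (1 - x))^-1 - (a + b * (x - y)))) by eexists.
have tangent (x : R) : 0 < x < 1 -> 0 <= (x * (1 - x))^-1 - (a + b * (x - y)).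
  move=> /andP[x0 x1].
  have w0 : 0 < x * (1 - x) by rewrite mulr_gt0//; lra.
  have -> : (x * (1 - x))^-1 - (a + b * (x - y)) =
      ((x * (1 - x) - s) ^+ 2 + (x - y) ^+ 2 * (x * (1 - x)))
      / (s ^+ 2 * (x * (1 - x))).
    by rewrite /a /b /s; field; repeat (apply/andP; split); lra.
  apply: divr_ge0; last by rewrite mulr_ge0 ?sqr_ge0 ?(ltW w0).
  by rewrite addr_ge0 ?sqr_ge0// mulr_ge0 ?sqr_ge0 ?(ltW w0).
have dG (x : R) : 0 < x < 1 -> is_derive x 1 G (G' x).
  move=> /andP[x0 x1].
  have x1' : 0 < 1 - x by lra.
  rewrite GE G'E; clear -x0 x1 x1'; derive; [exact: x0|exact: x1'|field].
  by apply/andP; split; lra.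
have Gpq : G q <= G p.
  have [pq|qp] := leP p q.
    suff : - G p <= - G q by lra.
    apply: (@derive_ge0_le R (fun x => - G x) (fun x => - G' x)) => //.
      move=> x /andP[px xq]; apply: is_deriveN_fun; apply: dG; lra.
    move=> x /andP[px xq]; rewrite G'E -mulNr mulr_ge0//; first lra.
    by apply: tangent; lra.
  apply: (@derive_ge0_le R G G'); first exact: ltW.
    by move=> x /andP[px xq]; apply: dG; lra.
  move=> x /andP[px xq]; rewrite G'E mulr_ge0//; first lra.
  by apply: tangent; lra.
rewrite /kl !ln_div ?posrE; [|lra..].
move: Gpq; rewrite GE.
(* The choice of y makes the contribution of the slope [b] vanish at x = p. *)
rewrite (_ : (p - q) ^+ 3 / 3 + _ = 0); last by rewrite yE; field.
rewrite (_ : (q - p) ^+ 2 / _ = a * (p - q) ^+ 2 / 2); last first.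
  by rewrite /a /s; field; apply/andP; split; lra.
rewrite subrr !expr0n/=; lra.
Qed.

(** * Binomial tails as finite sums *)

Definition bern {R : realType} (q : R) (b : bool) : R := if b then q else 1 - q.

Definition bern_word {R : realType} (q : R) {N : nat} (b : {ffun 'I_N -> bool}) : R :=
  \prod_(i < N) bern q (b i).

Definition heads {N : nat} (b : {ffun 'I_N -> bool}) : nat := \sum_(i < N) b i.

(** Summing over words instead of using binomial coefficients lets tilting act on each term, and
    each term is the mass of a cylinder event. *)
Definition tail_ge {R : realType} (N : nat) (q : R) (g : nat) : R :=
  \sum_(b : {ffun 'I_N -> bool} | (g <= heads b)%N) bern_word q b.

Definition tail_lt {R : realType} (N : nat) (q : R) (g : nat) : R :=
  \sum_(b : {ffun 'I_N -> bool} | (heads b < g)%N) bern_word q b.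

Lemma bern_ge0 {R : realType} (q : R) (b : bool) : 0 <= q <= 1 -> 0 <= bern q b.
Proof. by rewrite /bern; case: b; lra. Qed.

Lemma bern_word_ge0 {R : realType} (q : R) {N : nat} (b : {ffun 'I_N -> bool}) :
  0 <= q <= 1 -> 0 <= bern_word q b.
Proof. by move=> q01; apply: prodr_ge0 => i _; exact: bern_ge0. Qed.

(** Expectation of a product over independent bits, obtained by distributing the product over the
    sums. Taking for f the constant 1 or indicators gives the total mass and the laws of events. *)
Lemma sum_bern_word {R : realType} (q : R) (N : nat) (f : 'I_N -> bool -> R) :
  \sum_(b : {ffun 'I_N -> bool}) (bern_word q b * \prod_(i < N) f i (b i)) =
  \prod_(i < N) (q * f i true + (1 - q) * f i false).
Proof.
under [RHS]eq_bigr => i _.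
  rewrite (_ : _ + _ = \sum_(c : bool) bern q c * f i c); last by rewrite big_bool.
  over.
rewrite bigA_distr_bigA/=; apply: eq_bigr => b _.
by rewrite /bern_word -big_split.
Qed.

Lemma sum_bern_word1 {R : realType} (q : R) (N : nat) :
  \sum_(b : {ffun 'I_N -> bool}) bern_word q b = 1.
Proof.
have := @sum_bern_word R q N (fun _ _ => 1).
under eq_bigr do rewrite big1// mulr1.
by move=> ->; apply: big1 => i _; lra.
Qed.

Lemma tail_ge_le1 {R : realType} (N : nat) (q : R) (g : nat) :
  0 <= q <= 1 -> tail_ge N q g <= 1.
Proof.
move=> q01; rewrite -(@sum_bern_word1 R q N) /tail_ge big_mkcond/=.
by apply: ler_sum => b _; case: ifP => // _; exact: bern_word_ge0.
Qed.

Lemma tail_lt_le1 {R : realType} (N : nat) (q : R) (g : nat) :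
  0 <= q <= 1 -> tail_lt N q g <= 1.
Proof.
move=> q01; rewrite -(@sum_bern_word1 R q N) /tail_lt big_mkcond/=.
by apply: ler_sum => b _; case: ifP => // _; exact: bern_word_ge0.
Qed.

Lemma heads_le {N : nat} (b : {ffun 'I_N -> bool}) : (heads b <= N)%N.
Proof.
rewrite -[leqRHS]card_ord -sum1_card; apply: leq_sum => i _; exact: leq_b1.
Qed.

Lemma tail_ge_out {R : realType} (N : nat) (q : R) (g : nat) :
  (N < g)%N -> tail_ge N q g = 0.
Proof.
move=> Ng; apply: big_pred0 => b; apply/negbTE; rewrite -ltnNge.
exact: leq_ltn_trans (heads_le b) Ng.
Qed.

Lemma tail_ge_all {R : realType} (N : nat) (q : R) : 0 <= q <= 1 ->
  tail_ge N q N <= q ^+ N.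
Proof.
move=> q01.
rewrite (_ : q ^+ N = \prod_(i < N) (q * 1 + (1 - q) * 0)); last first.
  by rewrite prodr_const card_ord; congr (_ ^+ _); lra.
rewrite -(@sum_bern_word R q N (fun _ c => if c then 1 else 0)).
rewrite /tail_ge big_mkcond/=; apply: ler_sum => b _; case: ifP => [hb|_].
  rewrite big1 ?mulr1// => i _; case: ifPn => // bi.
  have : (heads b < N)%N.
    rewrite /heads (bigD1 i)//= (negbTE bi) add0n.
    rewrite -[ltnRHS]card_ord -sum1_card [ltnRHS](bigD1 i)//= add1n ltnS.
    by apply: leq_sum => j _; exact: leq_b1.
  by rewrite ltnNge hb.
rewrite mulr_ge0 ?bern_word_ge0//.
by apply: prodr_ge0 => i _; case: ifP.
Qed.

(** Letter by letter, p = q s / x for a head and 1 - p = (1 - q) s for a tail, where s normalises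
    the weights 1 - p and p x. *)
Lemma bern_word_tilt {R : realType} (p x q s : R) {N : nat} (b : {ffun 'I_N -> bool}) :
  0 < x -> 0 < s -> s = 1 - p + p * x -> q = p * x / s ->
  bern_word p b = bern_word q b * expR (N%:R * ln s - (heads b)%:R * ln x).
Proof.
move=> x0 s0 sE qE.
rewrite expRB expRM_natl expRM_natl !lnK ?posrE// /bern_word /heads.
have -> : s ^+ N = \prod_(i < N) s by rewrite prodr_const card_ord.
rewrite expr_sum -prodfV -!big_split/=.
apply: eq_bigr => i _; rewrite /bern; case: (b i); rewrite ?expr1 ?expr0 qE.
  by field; apply/andP; split; lra.
by rewrite sE; field; rewrite -sE; lra.
Qed.

(* Exponential tilting; bounding the remaining tail by 1 gives Chernoff's bound. *)
Lemma tail_ge_tilt {R : realType} (p x q s : R) (N g : nat) :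
  0 < p < 1 -> 1 <= x -> s = 1 - p + p * x -> q = p * x / s ->
  tail_ge N p g <= expR (N%:R * ln s - g%:R * ln x) * tail_ge N q g.
Proof.
move=> p01 x1 sE qE.
have s0 : 0 < s by rewrite sE; nra.
have q01 : 0 <= q <= 1.
  by rewrite qE divr_ge0 ?ler_pdivrMr ?mul1r; nra.
rewrite /tail_ge mulr_sumr; apply: ler_sum => b gb.
rewrite (@bern_word_tilt R p x q s)//; last lra.
rewrite mulrC ler_wpM2r ?bern_word_ge0// ler_expR lerD2l lerN2.
by rewrite ler_wpM2r ?ln_ge0// ler_nat.
Qed.

(** A word of the tail has at most g - 1 heads, which leaves a spare factor x. It is at most s
    because s - x = (1 - p)(1 - x), whence the exponent [N.+1] of s. *)
Lemma tail_lt_tilt {R : realType} (p x q s : R) (N g : nat) :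
  0 < p < 1 -> 0 < x <= 1 -> s = 1 - p + p * x -> q = p * x / s ->
  tail_lt N p g <= expR (N.+1%:R * ln s - g%:R * ln x) * tail_lt N q g.
Proof.
move=> p01 x1 sE qE.
have s0 : 0 < s by rewrite sE; nra.
have q01 : 0 <= q <= 1.
  by rewrite qE divr_ge0 ?ler_pdivrMr ?mul1r; nra.
rewrite /tail_lt mulr_sumr; apply: ler_sum => b gb.
rewrite (@bern_word_tilt R p x q s)//; last lra.
rewrite mulrC ler_wpM2r ?bern_word_ge0// ler_expR.
have lx : ln x <= 0 by apply: ln_le0; lra.
have lxs : ln x <= ln s by rewrite ler_ln ?posrE//; [rewrite sE; nra|lra].
have : (heads b).+1%:R <= g%:R :> R by rewrite ler_nat.
rewrite -!natr1; nra.
Qed.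

Lemma tail_ge_chernoff {R : realType} (p x s : R) (N g : nat) :
  0 < p < 1 -> 1 <= x -> s = 1 - p + p * x ->
  tail_ge N p g <= expR (N%:R * ln s - g%:R * ln x).
Proof.
move=> p01 x1 sE; apply: le_trans (@tail_ge_tilt R p x _ s N g _ _ sE erefl) _ => //.
have s0 : 0 < s by rewrite sE; nra.
rewrite ler_piMr ?expR_ge0// tail_ge_le1//.
by rewrite divr_ge0 ?ler_pdivrMr ?mul1r; nra.
Qed.

Lemma tail_lt_chernoff {R : realType} (p x s : R) (N g : nat) :
  0 < p < 1 -> 0 < x <= 1 -> s = 1 - p + p * x ->
  tail_lt N p g <= expR (N.+1%:R * ln s - g%:R * ln x).
Proof.
move=> p01 x1 sE; apply: le_trans (@tail_lt_tilt R p x _ s N g _ _ sE erefl) _ => //.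
have s0 : 0 < s by rewrite sE; nra.
rewrite ler_piMr ?expR_ge0// tail_lt_le1//.
by rewrite divr_ge0 ?ler_pdivrMr ?mul1r; nra.
Qed.

(** * Laws of Bernoulli words *)

Lemma fin_bigcup_measure {R : realType} {d : measure_display}
    {T : measurableType d} (P : probability T R) {I : finType}
    (A : pred I) (W : I -> set T) :
  (forall i, measurable (W i)) -> trivIset setT W ->
  P (\bigcup_(i in [set i | A i]) W i) = (\sum_(i | A i) P (W i))%E.
Proof.
move=> mW tW; rewrite measure_fin_bigcup//; last first.
- exact: sub_trivIset tW.
- exact: finite_finset.
- rewrite (_ : [set i | A i] = [set` A])//.
  rewrite -(@bigfs _ _ _ _ (index_enum I))//; first exact: index_enum_uniq.
  by move=> i _; rewrite mem_index_enum.
Qed.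

(** The values u, v are 1, 0 for the given variables and those of a centred coin for
    Berry-Esseen. *)
Definition word_event {R : realType} {T : Type} (X : nat -> T -> R) (u v : R)
    {N : nat} (b : {ffun 'I_N -> bool}) : set T :=
  [set w | forall i : 'I_N, X i w = if b i then u else v].

Lemma measurable_eq_cst {R : realType} {d : measure_display}
    {T : measurableType d} (X : {mfun T >-> R}) (c : R) :
  measurable [set w | X w = c].
Proof.
by rewrite (_ : [set w | X w = c] = X @^-1` [set c]).
Qed.

Lemma measurable_sum_rv {R : realType} {d : measure_display}
    {T : measurableType d} (X : nat -> {mfun T >-> R}) (n : nat) :
  measurable_fun [set: T] (fun w => \sum_(i < n) X i w).
Proof. by apply: measurable_sum => i; exact: measurable_funPT. Qed.

Lemma measurable_bool_set {d : measure_display} {T : measurableType d}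
    (f : T -> bool) : measurable_fun [set: T] f -> measurable [set w | f w].
Proof.
move=> mf; rewrite (_ : [set w | f w] = setT `&` f @^-1` [set true]).
  exact: mf.
by rewrite setTI.
Qed.

Lemma word_event_bigcap {R : realType} {T : Type} (X : nat -> T -> R) (u v : R)
    {N : nat} (b : {ffun 'I_N -> bool}) (c : nat -> bool) :
  (forall i : 'I_N, c i = b i) ->
  word_event X u v b =
  \bigcap_(j in [set` iota 0 N]) (X j @^-1` [set if c j then u else v]).
Proof.
move=> cb; apply/seteqP; split => w /= h.
  move=> j /=; rewrite mem_iota /= add0n => jN.
  by have := h (Ordinal jN); rewrite -cb.
move=> i; have := h i; rewrite /= mem_iota /= add0n ltn_ord => /(_ isT) ->.
by rewrite cb.
Qed.

Lemma measurable_word_event {R : realType} {d : measure_display}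
    {T : measurableType d} (X : nat -> {mfun T >-> R}) (u v : R)
    {N : nat} (b : {ffun 'I_N -> bool}) : measurable (word_event X u v b).
Proof.
rewrite (_ : word_event X u v b =
  \bigcap_(i in [set: 'I_N]) [set w | X i w = if b i then u else v]).
  by apply: fin_bigcap_measurable => // i _; exact: measurable_eq_cst.
by apply/seteqP; split => w h i; [move=> _|]; exact: h.
Qed.

Lemma trivIset_word_event {R : realType} {T : Type} (X : nat -> T -> R) (u v : R)
    {N : nat} : u <> v -> trivIset setT (@word_event R T X u v N).
Proof.
move=> uv b b' _ _ [w [hb hb']]; apply/ffunP => i.
by have := hb i; rewrite hb'; case: (b i); case: (b' i) => // /esym.
Qed.

Lemma prob_word_event {R : realType} {d : measure_display}
    {T : measurableType d} {P : probability T R} (X : nat -> {RV P >-> R})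
    (p : R) {N : nat} (b : {ffun 'I_N -> bool}) :
  iid_seq X -> bernoulli_rv p (X 0%N) ->
  P (word_event X 1 0 b) = (bern_word p b)%:E.
Proof.
move=> [indX idX] [X1 X0].
(* Outside the range of [b] the default is false; only indices below [N] are ever used. *)
pose c (j : nat) := if insub j is Some i then b i else false.
have cb (i : 'I_N) : c i = b i by rewrite /c valK.
rewrite (word_event_bigcap X 1 0 b c cb) indX ?iota_uniq//.
have -> : iota 0 N = index_iota 0 N by rewrite /index_iota subn0.
rewrite big_mkord.
rewrite /bern_word -prodEFin; apply: eq_bigr => i _.
by rewrite idX// cb /bern; case: (b i).
Qed.

Lemma prob_words_tail {R : realType} {d : measure_display}
    {T : measurableType d} {P : probability T R} (X : nat -> {RV P >-> R})
    (p : R) (N : nat) (A : pred {ffun 'I_N -> bool}) :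
  iid_seq X -> bernoulli_rv p (X 0%N) ->
  P (\bigcup_(b in [set b | A b]) word_event X 1 0 b) =
  (\sum_(b | A b) bern_word p b)%:E.
Proof.
move=> iidX bX; rewrite fin_bigcup_measure.
- by rewrite -sumEFin; apply: eq_bigr => b _; exact: prob_word_event.
- by move=> b; exact: measurable_word_event.
- by apply: trivIset_word_event => /eqP; rewrite oner_eq0.
Qed.

(** * A sequence of independent coins *)

(* [coin_step q] expands the unit interval piecewise linearly, mapping each of
   [0, q[ and [q, 1[ onto [0, 1[; cylinders of its symbolic coding are
   intervals of length bern_word, so the coding of a uniform point is a
   sequence of independent q-coins. *)
Definition coin_step {R : realType} (q x : R) : R :=
  if x < q then x / q else (x - q) / (1 - q).

Definition coin {R : realType} (q : R) (i : nat) (x : R) : bool :=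
  iter i (coin_step q) x < q.

Definition coin_prob (R : realType) : probability _ R := uniform_prob (@ltr01 R).

Lemma measurable_coin {R : realType} (q : R) (i : nat) :
  measurable_fun [set: R] (coin q i).
Proof.
rewrite /coin; apply: measurable_fun_ltr => //.
elim: i => [|i IH]; first exact: measurable_id.
have mstep : measurable_fun [set: R] (@coin_step R q).
  rewrite /coin_step; apply: measurable_fun_ifT.
  - exact: measurable_fun_ltr.
  - exact: measurable_funM.
  - by apply: measurable_funM => //; exact: measurable_funB.
exact: (measurableT_comp mstep IH).
Qed.

(** Induction on the first bit: it selects a branch of [coin_step], and the inverse branch pulls the
    interval of the remaining bits back, scaling it by [bern q c]. *)
Lemma coin_cylinder {R : realType} (q : R) (s : seq bool) : 0 < q < 1 ->
  exists2 a : R, 0 <= a /\ a + \prod_(c <- s) bern q c <= 1 &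
    forall x : R, (0 <= x < 1) && [forall i : 'I_(size s), coin q i x == nth false s i]
       = (a <= x < a + \prod_(c <- s) bern q c).
Proof.
move=> /andP[q0 q1]; elim: s => [|c s [a [a0 a1] IH]].
  exists 0; rewrite big_nil ?add0r//.
  move=> x; suff -> : [forall i : 'I_(@size bool [::]),
    coin q i x == nth false [::] i] by rewrite andbT.
  by apply/forallP => -[].
set l := \prod_(_ <- s) _ in a1 IH.
have step x : [forall i : 'I_(size (c :: s)), coin q i x == nth false (c :: s) i]
    = ((x < q) == c) && [forall i : 'I_(size s), coin q i (coin_step q x) == nth false s i].
  apply/forallP/andP => [h|[hc /forallP h] [[|i] /= hi]].
  - split; first exact: (h ord0).
    apply/forallP => i; have := h (lift ord0 i).
    by rewrite /= /bump/= add1n/= /coin iterSr.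
  - exact: hc.
  - by have := h (Ordinal (hi : (i < size s)%N)); rewrite /coin -iterSr.
have q1' : 0 < 1 - q by lra.
have l0 : 0 <= l by apply: prodr_ge0 => i _; apply: bern_ge0; lra.
(* Image of the left endpoint under the inverse branch: y -> q y onto [0, q[, and y -> q + (1 - q) y
   onto [q, 1[. *)
exists (if c then q * a else q + (1 - q) * a); rewrite big_cons -/l /bern.
  by case: c {step}; split; nra.
move=> x; rewrite step.
have [xq|qx] := ltP x q; case: c {step} => /=; rewrite ?andbF.
- have := IH (coin_step q x); rewrite /coin_step xq.
  have -> : (0 <= x / q < 1) = (0 <= x < 1).
    rewrite ler_pdivlMr// mul0r ltr_pdivrMr// mul1r xq.
    by rewrite (lt_trans xq q1).
  move=> ->; rewrite ler_pdivlMr// ltr_pdivrMr//.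
  by rewrite mulrDl ![_ * q]mulrC.
- symmetry; apply/negbTE/negP => /andP[h _]; nra.
- symmetry; apply/negbTE/negP => /andP[_ h]; nra.
- have := IH (coin_step q x); rewrite /coin_step ltNge qx/=.
  have -> : (0 <= (x - q) / (1 - q) < 1) = (0 <= x < 1).
    rewrite ler_pdivlMr// mul0r ltr_pdivrMr// mul1r.
    by rewrite subr_ge0 qx (le_trans (ltW q0) qx)/= ltrD2r.
  move=> ->; rewrite ler_pdivlMr// ltr_pdivrMr//.
  by rewrite lerBrDl ltrBlDl -addrA -mulrDr [(a + l) * _]mulrC [a * _]mulrC.
Qed.

Lemma coin_prob_itv {R : realType} (a b : R) : 0 <= a -> a <= b -> b <= 1 ->
  coin_prob R `[a, b[%classic = (b - a)%:E.
Proof.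
move=> a0 ab b1; rewrite /coin_prob/= /uniform_prob integral_uniform_pdf.
rewrite setIidl; last first.
  by move=> x; rewrite /= !in_itv/=; lra.
rewrite (eq_integral (fun=> 1%:E)); last first.
  move=> x; rewrite inE/= in_itv/= => xab.
  by rewrite /uniform_pdf ifT; [rewrite subr0 invr1|lra].
rewrite integral_cst//= lebesgue_measure_itv/= lte_fin mul1e.
by case: ltP => // ba; rewrite (_ : b = a) ?subrr//; lra.
Qed.

(** The uniform law charges only [0, 1[, where [coin_cylinder] describes the coding. *)
Lemma coin_prob_restrict {R : realType} (A B : set (measurableTypeR R)) :
  measurable A -> measurable B -> A `&` `[0, 1[%classic = B `&` `[0, 1[%classic ->
  coin_prob R A = coin_prob R B.
Proof.
move=> mA mB AB.
have h (C : set (measurableTypeR R)) : measurable C -> coin_prob R C = coin_prob R (C `&` `[0, 1[%classic).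
  move=> mC.
  have : coin_prob R (~` `[0, 1[%classic) = 0%E.
    by rewrite probability_setC// coin_prob_itv// subr0 subee.
  move=> D0; rewrite -{1}(setIT C) -(setUv `[0, 1[%classic) setIUr measureU0//.
  - exact: measurableI.
  - by apply: measurableI => //; exact: measurableC.
  - apply: (@subset_measure0 _ _ _ (coin_prob R) _ (~` `[0, 1[%classic)) => //.
      by apply: measurableI => //; exact: measurableC.
    exact: measurableC.
by rewrite (h A)// (h B)// AB.
Qed.

Definition coin_val {R : realType} (q u v : R) (i : nat) (x : R) : R :=
  if coin q i x then u else v.

Lemma measurable_coin_val {R : realType} (q u v : R) (i : nat) :
  measurable_fun [set: measurableTypeR R] (coin_val q u v i).
Proof.
have : measurable_fun [set: R] (coin_val q u v i).
  by apply: measurable_fun_ifT => //; exact: measurable_coin.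
exact.
Qed.

Definition coin_rv {R : realType} (q u v : R) (i : nat) : {RV (coin_prob R) >-> R} :=
  HB.pack (coin_val q u v i)
    (isMeasurableFun.Build _ _ _ _ _ (measurable_coin_val q u v i)).

Lemma coin_word_prob {R : realType} (q u v : R) {N : nat} (b : {ffun 'I_N -> bool}) :
  0 < q < 1 -> u <> v ->
  coin_prob R (word_event (coin_rv q u v) u v b) = (bern_word q b)%:E.
Proof.
move=> q01 uv; pose s := [seq b i | i <- enum 'I_N].
have [a [a0 a1] H] := coin_cylinder q s q01.
have sN : size s = N by rewrite size_map size_enum_ord.
have nths (i : 'I_N) : nth false s i = b i.
  by rewrite (nth_map i) ?size_enum_ord// nth_ord_enum.
have sb : \prod_(c <- s) bern q c = bern_word q b by rewrite big_map big_enum.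
rewrite sb in a1 H.
have b0 : 0 <= bern_word q b by apply: bern_word_ge0; lra.
rewrite (@coin_prob_restrict R _ `[a, a + bern_word q b[%classic) ?coin_prob_itv//.
- by rewrite addrAC subrr add0r.
- by lra.
- exact: measurable_word_event.
- apply/seteqP; split => x /=; rewrite !in_itv/=.
    move=> [hx x01]; split => //; rewrite -H x01/=; apply/forallP => i.
    have iN : (i < N)%N by rewrite -sN ltn_ord.
    rewrite (nths (Ordinal iN)); have := hx (Ordinal iN).
    by rewrite /= /coin_val; case: (coin q i x); case: (b _) => // /esym.
  move=> [xab x01]; split => // i.
  move: xab; rewrite -H => /andP[_ /forallP].
  have iN : (i < size s)%N by rewrite sN.
  by move=> /(_ (Ordinal iN)) /eqP /=; rewrite nths /coin_val => ->.
Qed.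

(** The event depends only on the coins of index below [N], so it is a disjoint union of word
    events, and its mass factors by [sum_bern_word]. An index outside [J] contributes q + (1 - q) =
    1. *)
Lemma coin_law {R : realType} (q u v : R) (J : seq nat) (B : nat -> set R) :
  0 < q < 1 -> u <> v -> uniq J ->
  coin_prob R (\bigcap_(j in [set` J]) (coin_rv q u v j @^-1` B j)) =
  (\prod_(j <- J) (q * \1_(B j) u + (1 - q) * \1_(B j) v))%:E.
Proof.
move=> q01 uv uJ.
pose N := (\max_(j <- J) j).+1.
have JN j : j \in J -> (j < N)%N.
  by move=> jJ; rewrite ltnS; exact: leq_bigmax_seq.
pose A (b : {ffun 'I_N -> bool}) :=
  [forall i : 'I_N, (val i \in J) ==> ((if b i then u else v) \in B i)].
rewrite (_ : \bigcap_(j in _) _ =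
    \bigcup_(b in [set b | A b]) word_event (coin_rv q u v) u v b); last first.
  apply/seteqP; split => x.
    move=> hx; exists [ffun i : 'I_N => coin q i x]; last by move=> i; rewrite ffunE.
    rewrite /=; apply/forallP => i; apply/implyP => iJ; rewrite ffunE inE.
    exact: hx.
  move=> [b /forallP Ab hb] j /= jJ.
  have := Ab (Ordinal (JN _ jJ)); rewrite jJ/= inE.
  by rewrite -(hb (Ordinal (JN _ jJ))).
rewrite fin_bigcup_measure; last 2 first.
- by move=> b; exact: measurable_word_event.
- exact: trivIset_word_event.
rewrite (eq_bigr (fun b => (bern_word q b)%:E)); last first.
  by move=> b _; exact: coin_word_prob.
rewrite sumEFin; congr _%:E.
pose f (i : 'I_N) (c : bool) : R :=
  if val i \in J then \1_(B i) (if c then u else v) else 1.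
transitivity (\sum_(b : {ffun 'I_N -> bool}) (bern_word q b * \prod_(i < N) f i (b i))).
  rewrite big_mkcond/=; apply: eq_bigr => b _; case: ifP => [/forallP Ab|/negbT].
    rewrite big1 ?mulr1// => i _; rewrite /f; case: ifP => // iJ.
    by have := Ab i; rewrite iJ/= indicE => ->.
  rewrite negb_forall => /existsP[i]; rewrite negb_imply => /andP[iJ /negbTE hB].
  by rewrite (bigD1 i)//= {1}/f iJ indicE hB mul0r mulr0.
rewrite sum_bern_word.
transitivity (\prod_(i < N | val i \in J) (q * \1_(B i) u + (1 - q) * \1_(B i) v)).
  rewrite [RHS]big_mkcond/=; apply: eq_bigr => i _; rewrite /f.
  by case: ifP => // _; lra.
rewrite -(big_mkord (fun i => i \in J) (fun i => q * \1_(B i) u + (1 - q) * \1_(B i) v)).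
rewrite -big_filter; apply: perm_big; apply: uniq_perm => //.
  by rewrite filter_uniq// iota_uniq.
move=> j; rewrite mem_filter mem_index_iota leq0n/=.
by case: (boolP (j \in J)) => //= /JN ->.
Qed.

Lemma coin_law1 {R : realType} (q u v : R) (j : nat) (B : set R) :
  0 < q < 1 -> u <> v ->
  coin_prob R (coin_rv q u v j @^-1` B) = (q * \1_B u + (1 - q) * \1_B v)%:E.
Proof.
move=> q01 uv; have := coin_law q u v [:: j] (fun=> B) q01 uv isT.
rewrite big_seq1 => <-; congr (coin_prob R _).
apply/seteqP; split => x /=; first by move=> h k /=; rewrite inE => /eqP ->.
by move=> /(_ j); apply; rewrite /= inE.
Qed.

Lemma coin_iid {R : realType} (q u v : R) : 0 < q < 1 -> u <> v ->
  iid_seq (coin_rv q u v).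
Proof.
move=> q01 uv; split.
  move=> J B uJ mB; rewrite coin_law// -prodEFin; apply: eq_bigr => j _.
  by rewrite coin_law1.
by move=> i B mB; rewrite !coin_law1.
Qed.

(** The integral is split over heads and tails, so a and b may coincide, as the squared values of a
    centred coin do at q = 1/2. *)
Lemma coin_expectation {R : realType} (q a b : R) : 0 < q < 1 ->
  ('E_(coin_prob R)[coin_val q a b 0] = (q * a + (1 - q) * b)%:E)%E.
Proof.
move=> q01; rewrite unlock.
pose H : set (measurableTypeR R) := [set x | coin q 0 x].
have mH : measurable H.
  by have := @measurable_coin R q 0 measurableT [set true] I; rewrite setTI.
have PH : coin_prob R H = q%:E.
  have /= := @coin_law1 R q 1 0 0 [set 1] q01 ltac:(by move/eqP; rewrite oner_eq0).
  rewrite !indicE mem_set// memNset/=; last by move/esym/eqP; rewrite oner_eq0.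
  rewrite mulr1 mulr0 addr0 => <-; congr (coin_prob R _).
  apply/seteqP; split => x; rewrite /H /= /coin_val; first by move=> ->.
  by case: ifP => // _ /esym/eqP; rewrite oner_eq0.
have PHC : coin_prob R (~` H) = (1 - q)%:E by rewrite probability_setC// PH.
have mHC : measurable (~` H) by exact: measurableC.
rewrite -(setUv H) integral_setU//; last 2 first.
- apply/measurable_EFinP; rewrite setUv; exact: measurable_coin_val.
- exact/disj_setPCl.
rewrite (eq_integral (cst a%:E)); last by move=> x; rewrite inE /coin_val => ->.
rewrite [X in (_ + X)%E](eq_integral (cst b%:E)); last first.
  by move=> x; rewrite inE /coin_val /H /= => /negP/negbTE ->.
rewrite !integral_cst//.
rewrite [LHS](_ : _ = a%:E * coin_prob R H + b%:E * coin_prob R (~` H))%E//.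
rewrite PH PHC -!EFinM -EFinD; congr _%:E; lra.
Qed.

(** * Berry-Esseen at the mean *)

(** The density is even, so its total integral 1 is twice that over the positive half-line. *)
Lemma Phi0 {R : realType} : Phi (0 : R) = 2^-1.
Proof.
pose f : R -> R := normal_pdf 0 1.
have fc : continuous f by apply: continuous_normal_pdf; rewrite oner_eq0.
have fs : f =1 f \o -%R.
  by move=> x; rewrite /f normal_pdfE ?oner_eq0//= /normal_fun !subr0 sqrrN.
have f0 x : 0 <= f x by exact: normal_pdf_ge0.
have mf : measurable_fun [set: R] (EFin \o f).
  by apply/measurable_EFinP; exact: measurable_normal_pdf.
have := @ge0_symfun_integralT R f f0 fc fs.
rewrite integral_normal_pdf.
have -> : [set x : R | 0 <= x] = `[0, +oo[%classic.
  by apply/seteqP; split => x; rewrite /= in_itv/= andbT.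
rewrite -integral_itv_obnd_cbnd; last exact: measurable_funTS mf.
have -> : (\int[lebesgue_measure]_(x in `]0%R, +oo[) (f x)%:E =
           (1 - normal_prob 0 1 `]-oo, 0%R])%E)%E.
  rewrite -probability_setC// setCitvl.
  by rewrite /normal_prob.
rewrite /Phi.
have : (normal_prob 0 1 `]-oo, (0 : R)%R] \is a fin_num)%E by exact: fin_num_measure.
case: (normal_prob 0 1 `]-oo, (0 : R)%R]) => // r _.
rewrite -EFinB -EFinM => -[]/=; lra.
Qed.

(* sg = -1 gives the upper tail and sg = 1 the lower tail at the mean. *)
Lemma berry_esseen_words {R : realType} (C q sg : R) (N : nat) :
  berry_esseen_constant C -> 0 < q < 1 -> (0 < N)%N -> sg ^+ 2 = 1 ->
  0 <= C /\
  \sum_(b : {ffun 'I_N -> bool} | sg * ((heads b)%:R - N%:R * q) <= 0) bern_word q b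
    <= 2^-1 + C / Num.sqrt (N%:R * (q * (1 - q))).
Proof.
move=> BE q01 N0 sg2.
have sg0 : sg != 0 by apply/eqP => sE; move: sg2; rewrite sE; lra.
(* The two values of the centred signed coin sg (bit - q). *)
pose u := sg * (1 - q); pose v := - (sg * q).
have uv : u <> v by rewrite /u /v => /eqP; rewrite -subr_eq0 opprK -mulrDr subrK mulr1; apply/negP.
have nsg : `|sg| = 1.
  by apply/eqP; rewrite -(@eqrXn2 _ 2)// ?real_normK ?num_real// sg2 expr1n.
have fE (g : R -> R) : (fun w => g (coin_rv q u v 0 w)) = coin_val q (g u) (g v) 0.
  by apply/funext => w; rewrite /= /coin_val; case: ifP.
have E1 : ('E_(coin_prob R)[coin_rv q u v 0] = 0)%E.
  rewrite (_ : (coin_rv q u v 0 : _ -> _) = coin_val q u v 0)// coin_expectation//.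
  by congr _%:E; rewrite /u /v; ring.
have E2 : ('E_(coin_prob R)[fun w => (coin_rv q u v 0 w ^+ 2)%R] = (q * (1 - q))%:E)%E.
  rewrite (fE (fun x => x ^+ 2)) coin_expectation//; congr _%:E.
  rewrite /u /v sqrrN !exprMn sg2; ring.
have E3 : ('E_(coin_prob R)[fun w => (`|coin_rv q u v 0 w| ^+ 3)%R] =
   (q * (1 - q) * (q ^+ 2 + (1 - q) ^+ 2))%:E)%E.
  rewrite (fE (fun x => `|x| ^+ 3)) coin_expectation//; congr _%:E.
  rewrite /u /v normrN !normrM nsg !mul1r !ger0_norm; [ring|lra|lra].
have := BE _ _ (coin_prob R) (coin_rv q u v) (coin_iid q u v q01 uv) E1.
have qq0 : 0 < q * (1 - q) by rewrite mulr_gt0; lra.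
rewrite E2 E3 lte_fin ltry => /(_ qq0 isT N 0 N0) /=.
rewrite Phi0.
set Pr := fine _; set s2 := q * (1 - q) in qq0 *.
set t := q ^+ 2 + (1 - q) ^+ 2.
have t1 : 0 < t <= 1 by rewrite /t; nra.
have N0' : 0 < N%:R :> R by rewrite ltr0n.
have sN0 : 0 < Num.sqrt N%:R :> R by rewrite sqrtr_gt0.
have ratioE (a : R) : 0 < a -> C / Num.sqrt N%:R * (a * t / Num.sqrt a ^+ 3) =
          C * t / (Num.sqrt (N%:R * a)).
  move=> a0; have sa0 : 0 < Num.sqrt a by rewrite sqrtr_gt0.
  rewrite sqrtrM ?ler0n// -{1}(sqr_sqrtr (ltW a0)).
  by field; apply/andP; split; rewrite gt_eqF.
rewrite ratioE//.
have s0 : 0 < Num.sqrt (N%:R * s2) by rewrite sqrtr_gt0 mulr_gt0.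
move=> h.
(* The Berry-Esseen bound dominates an absolute value, and its other factors are positive. *)
have C0 : 0 <= C.
  have : 0 <= C * t / Num.sqrt (N%:R * s2) by exact: le_trans h.
  by rewrite pmulr_lge0 ?invr_gt0// pmulr_lge0//; lra.
split => //.
have h2 : Pr <= 2^-1 + C / Num.sqrt (N%:R * s2).
  have : C * t / Num.sqrt (N%:R * s2) <= C / Num.sqrt (N%:R * s2).
    by rewrite ler_wpM2r ?invr_ge0 ?(ltW s0)// ler_piMr//; lra.
  move: h; rewrite ler_norml; lra.
have mE : measurable
    [set w | (\sum_(i < N) coin_rv q u v i w) / Num.sqrt (N%:R * s2) <= 0].
  apply: measurable_bool_set; apply: measurable_fun_ler => //.
  by apply: measurable_funM => //; exact: measurable_sum_rv.
apply: le_trans h2; rewrite -lee_fin /Pr fineK; last first.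
  exact: fin_num_measure.
rewrite -sumEFin (eq_bigr (fun b => coin_prob R (word_event (coin_rv q u v) u v b))); last first.
  by move=> b _; rewrite coin_word_prob.
rewrite -fin_bigcup_measure; last 2 first.
- by move=> b; exact: measurable_word_event.
- exact: trivIset_word_event.
apply: le_measure; rewrite ?inE//.
- apply: fin_bigcup_measurable; first exact: finite_finset.
  by move=> b _; exact: measurable_word_event.
move=> x [b /= hb hx].
rewrite (eq_bigr (fun i : 'I_N => sg * ((b i)%:R - q))); last first.
  by move=> i _; rewrite hx /u /v; case: (b i) => /=; ring.
rewrite -mulr_sumr sumrB -natr_sum sumr_const card_ord -[q *+ N]mulr_natl.
by rewrite pmulr_lle0// invr_gt0.
Qed.

(** * The event of a small relative error *)

Lemma measurable_good_event {R : realType} {d : measure_display}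
    {T : measurableType d} {P : probability T R} (X : nat -> {RV P >-> R})
    (g : nat) (p e : R) : measurable (good_event X g p e).
Proof.
rewrite (_ : good_event X g p e = \bigcup_n
    ([set w | \sum_(i < n.-1) X i w < g%:R] `&` [set w | \sum_(i < n) X i w == g%:R]
     `&` [set _ | `|(g%:R / n%:R - p) / p| < e])); last first.
  apply/seteqP; split => [w [n [h1 [h2 h3]]]|w [n _ [[h1 /eqP h2] h3]]].
    by exists n => //; split => //; split => //; exact/eqP.
  by exists n.
apply: bigcup_measurable => n _; apply: measurableI; first apply: measurableI.
- apply: measurable_bool_set; apply: measurable_fun_ltr => //.
  exact: measurable_sum_rv.
- apply: measurable_bool_set; apply: measurable_fun_eqr => //.
  exact: measurable_sum_rv.
- have [h|h] := boolP (`|(g%:R / n%:R - p) / p| < e).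
    by rewrite (_ : [set _ | _] = setT)//; apply/seteqP; split.
  by rewrite (_ : [set _ | _] = set0)//; apply/seteqP; split.
Qed.

Lemma estimator_close {R : realType} (g n : nat) (p e : R) : 0 < p -> (0 < n)%N ->
  g%:R < n%:R * ((1 + e) * p) -> n%:R * ((1 - e) * p) < g%:R ->
  `|(g%:R / n%:R - p) / p| < e.
Proof.
move=> p0 n0 gu gl; have n0' : 0 < n%:R :> R by rewrite ltr0n.
rewrite ltr_norml ltr_pdivlMr// ltr_pdivrMr//.
rewrite ltrBrDr ltrBlDr ltr_pdivlMr// ltr_pdivrMr//.
by apply/andP; split; lra.
Qed.

Lemma good_event_ge {R : realType} {d : measure_display}
    {T : measurableType d} {P : probability T R} (X : nat -> {RV P >-> R})
    (g N1 N2 : nat) (p e : R) :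
  iid_seq X -> bernoulli_rv p (X 0%N) -> (0 < g)%N -> 0 < p < 1 -> 0 < e ->
  g%:R < N1.+1%:R * ((1 + e) * p) -> N2%:R * ((1 - e) * p) < g%:R ->
  ((1 - (tail_ge N1 p g + tail_lt N2 p g))%:E <= P (good_event X g p e))%E.
Proof.
move=> iidX bX g0 /andP[p0 p1] e0 hN1 hN2.
pose M := maxn N1 N2.
(* Almost surely the first [M] variables are 0 or 1; [M] covers both cut-offs, so partial sums up to
   either are counts. *)
pose Z := \bigcup_(b in [set b | predT b]) @word_event R T X 1 0 M b.
pose A1 := \bigcup_(b in [set b | (g <= heads b)%N]) @word_event R T X 1 0 N1 b.
pose A2 := \bigcup_(b in [set b | (heads b < g)%N]) @word_event R T X 1 0 N2 b.
have mW N (A : pred {ffun 'I_N -> bool}) :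
    measurable (\bigcup_(b in [set b | A b]) word_event X 1 0 b).
  apply: fin_bigcup_measurable; first exact: finite_finset.
  by move=> b _; exact: measurable_word_event.
have PZ : P (~` Z) = 0%E.
  rewrite probability_setC; last exact: mW.
  by rewrite /Z (prob_words_tail X p M predT)// sum_bern_word1 subee.
have PA1 : P A1 = (tail_ge N1 p g)%:E by exact: prob_words_tail.
have PA2 : P A2 = (tail_lt N2 p g)%:E by exact: prob_words_tail.
have cover : [set: T] `<=` good_event X g p e `|` (A1 `|` A2 `|` ~` Z).
  move=> w _.
  have [Zw|] := pselect (Z w); last by right; right.
  have [A1w|A1w] := pselect (A1 w); first by right; left; left.
  have [A2w|A2w] := pselect (A2 w); first by right; left; right.
  left; case: Zw => b0 _ hb0.
  pose c (j : nat) : bool := X j w == 1.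
  have Xc j : (j < M)%N -> X j w = if c j then 1 else 0.
    move=> jM; rewrite /c (hb0 (Ordinal jM)); case: (b0 _); first by rewrite eqxx.
    by rewrite eq_sym oner_eq0.
  pose s n := (\sum_(i < n) c i)%N.
  have Xs n : (n <= M)%N -> \sum_(i < n) X i w = (s n)%:R.
    move=> nM; rewrite /s natr_sum; apply: eq_bigr => i _.
    by rewrite Xc; [case: (c i)|exact: leq_trans (ltn_ord i) nM].
  have sW n : (n <= M)%N -> @word_event R T X 1 0 n [ffun i : 'I_n => c i] w.
    by move=> nM i; rewrite ffunE Xc//; exact: leq_trans (ltn_ord i) nM.
  have sh n : heads [ffun i : 'I_n => c i] = s n.
    by rewrite /heads; apply: eq_bigr => i _; rewrite ffunE.
  have s1 : (s N1 < g)%N.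
    rewrite ltnNge; apply/negP => h; apply: A1w.
    by exists [ffun i : 'I_N1 => c i]; [rewrite /= sh|exact/sW/leq_maxl].
  have s2 : (g <= s N2)%N.
    rewrite leqNgt; apply/negP => h; apply: A2w.
    by exists [ffun i : 'I_N2 => c i]; [rewrite /= sh|exact/sW/leq_maxr].
  have sS n : s n.+1 = (s n + c n)%N by rewrite /s big_ord_recr.
  have smono n k : (n <= k)%N -> (s n <= s k)%N.
    elim: k => [|k IH]; first by rewrite leqn0 => /eqP ->.
    rewrite leq_eqVlt => /predU1P[->//|]; rewrite ltnS => /IH h.
    by rewrite sS (leq_trans h)// leq_addr.
  (* The stopping time is the least such n. Counts grow by at most 1, so the partial sum at n equals
     g exactly, and N1 < n <= N2. *)
  have ex : exists n, (g <= s n)%N by exists N2.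
  case: (ex_minnP ex) => n gn minn.
  have nN2 : (n <= N2)%N by exact: minn.
  have nM : (n <= M)%N by rewrite (leq_trans nN2)// leq_maxr.
  have N1n : (N1 < n)%N.
    by rewrite ltnNge; apply/negP => /smono; rewrite leqNgt (leq_trans s1).
  case: n => [//|n] in gn minn nN2 nM N1n *.
  have sn : (s n < g)%N.
    by rewrite ltnNge; apply/negP => /minn; rewrite ltnn.
  have sn1 : s n.+1 = g.
    apply/eqP; rewrite eqn_leq gn andbT sS.
    by rewrite (leq_trans _ sn)// -addn1 leq_add2l leq_b1.
  exists n.+1; split; first by rewrite Xs/= ?ltr_nat// (leq_trans _ nM).
  split; first by rewrite Xs ?sn1.
  apply: estimator_close => //.
    apply: (lt_le_trans hN1); rewrite ler_wpM2r ?ler_nat//.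
    by rewrite mulr_ge0; lra.
  (* For e > 1 the lower inequality is automatic, its left side being negative; otherwise it follows
     from n <= N2. *)
  have [e1|e1] := leP e 1; last first.
    apply: (@lt_trans _ _ 0); last by rewrite ltr0n.
    by rewrite pmulr_rlt0 ?ltr0n// pmulr_llt0//; lra.
  apply: le_lt_trans hN2; rewrite ler_wpM2r ?ler_nat//.
  by rewrite mulr_ge0; lra.
have mG := measurable_good_event X g p e.
have mA1 : measurable A1 by exact: mW.
have mA2 : measurable A2 by exact: mW.
have mZ : measurable (~` Z) by apply: measurableC; exact: mW.
have : (P [set: T] <= P (good_event X g p e) + (tail_ge N1 p g + tail_lt N2 p g)%:E)%E.
  apply: (@le_trans _ _ (P (good_event X g p e `|` (A1 `|` A2 `|` ~` Z)))).
    apply: le_measure => //; rewrite inE//.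
    by apply: measurableU => //; apply: measurableU => //; exact: measurableU.
  apply: (@le_trans _ _ (P (good_event X g p e) + P (A1 `|` A2 `|` ~` Z))%E).
    by apply: measureU2 => //; apply: measurableU => //; exact: measurableU.
  rewrite leeD2l// measureU0//; last exact: measurableU.
  by rewrite EFinD -PA1 -PA2; exact: measureU2.
rewrite probability_setT.
have : P (good_event X g p e) \is a fin_num by exact: fin_num_measure.
case: (P (good_event X g p e)) => // r _.
by rewrite -EFinD !lee_fin; lra.
Qed.

Lemma floor_nat {R : realType} (x : R) : 0 <= x ->
  exists N : nat, N%:R <= x /\ x < N.+1%:R.
Proof.
move=> x0; exists (Num.truncn x).
by have /andP[] := truncn_itv x0.
Qed.

Lemma ceil_pred_nat {R : realType} (x : R) : 0 < x ->
  exists N : nat, N%:R < x /\ x <= N.+1%:R.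
Proof.
move=> x0; have [N [N1 N2]] := @floor_nat R x (ltW x0).
have [NE|NE] := eqVneq (N%:R : R) x; last first.
  by exists N; rewrite lt_neqAle NE N1 (ltW N2).
case: N => [|N] in N1 N2 NE *; first by rewrite -NE ltxx in x0.
by exists N; rewrite NE lexx -NE ltr_nat.
Qed.

(** * Chernoff bounds *)

(** The tilt x = 1 + e has s = 1 + p e, and ln s <= p e lets the hypothesis on N remove both N and
    p. *)
Lemma tail_ge_rate {R : realType} (p e : R) (N g : nat) :
  0 < p < 1 -> 0 < e -> N%:R * ((1 + e) * p) <= g%:R ->
  tail_ge N p g <= expR (- (g%:R * rate e)).
Proof.
move=> p01 e0 h; have e1 : 0 < 1 + e by lra.
apply: le_trans (@tail_ge_chernoff R p (1 + e) (1 + p * e) N g p01 _ _) _; [lra|lra|].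
rewrite ler_expR.
have l1 : ln (1 + p * e) <= p * e by apply: le_ln1Dx; nra.
have l2 : N%:R * ln (1 + p * e) <= N%:R * (p * e) by rewrite ler_wpM2l.
have l3 : N%:R * (p * e) <= g%:R * (e / (1 + e)).
  by rewrite [leRHS]mulrA ler_pdivlMr//; nra.
by rewrite /rate; lra.
Qed.

(** Shared by the plain Chernoff bound and its Berry-Esseen refinement, both tilted by 1 - e. *)
Lemma lower_exponent_le {R : realType} (p e : R) (N g : nat) :
  0 < p < 1 -> 0 < e < 1 -> g%:R <= N.+1%:R * ((1 - e) * p) ->
  N.+1%:R * ln (1 - p * e) - g%:R * ln (1 - e) <= - (g%:R * rate e).
Proof.
move=> /andP[p0 p1] /andP[e0 e1] h; have e1' : 0 < 1 - e by lra.
have l1 : ln (1 - p * e) <= - (p * e) by apply: le_ln1Dx; nra.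
have l2 : N.+1%:R * ln (1 - p * e) <= N.+1%:R * - (p * e) by rewrite ler_wpM2l.
have l3 : g%:R * (e / (1 - e)) <= N.+1%:R * (p * e).
  by rewrite [leLHS]mulrA ler_pdivrMr//; nra.
have := @rate_le_lower R e ltac:(lra).
have : (0 : R) <= g%:R by [].
nra.
Qed.

Lemma tail_lt_rate {R : realType} (p e : R) (N g : nat) :
  0 < p < 1 -> 0 < e < 1 -> g%:R <= N.+1%:R * ((1 - e) * p) ->
  tail_lt N p g <= expR (- (g%:R * rate e)).
Proof.
move=> p01 e01 h.
apply: le_trans (@tail_lt_chernoff R p (1 - e) (1 - p * e) N g p01 _ _) _; [lra|lra|].
by rewrite ler_expR lower_exponent_le.
Qed.

(** For eps >= 1 the estimate cannot be too small, so the second cut-off may be as large as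
    desired. *)
Lemma tail_lt_small {R : realType} (p eta : R) (g : nat) :
  0 < p < 1 -> 0 < eta -> exists N, tail_lt N p g <= eta.
Proof.
move=> p01 eta0.
(* Chosen so that Chernoff's exponent at x = 1/2, at most g ln 2 - (N + 1) p / 2, falls below ln
   eta. The maximum with 0 serves [floor_nat]. *)
have [N [_ hN]] := @floor_nat R (Num.max 0 ((g%:R * ln 2 - ln eta) / (p / 2)))
  ltac:(by rewrite le_max lexx).
exists N; have {hN} : (g%:R * ln 2 - ln eta) / (p / 2) <= N.+1%:R.
  by rewrite (le_trans _ (ltW hN))// le_max lexx orbT.
rewrite ler_pdivrMr; last lra.
move=> hN.
apply: le_trans (@tail_lt_chernoff R p 2^-1 (1 - p / 2) N g p01 _ _) _; [lra|lra|].
rewrite -[leRHS]lnK ?posrE// ler_expR lnV ?posrE//.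
have l1 : ln (1 - p / 2) <= - (p / 2) by apply: le_ln1Dx; lra.
have l2 : N.+1%:R * ln (1 - p / 2) <= N.+1%:R * - (p / 2) by rewrite ler_wpM2l.
move: hN l2; lra.
Qed.

(** The two logarithms are those of the factor x that tilts a p-coin into a q-coin and of its
    normalisation s, so kl is the optimal Chernoff exponent per toss. *)
Lemma klE {R : realType} (p q : R) : 0 < p < 1 -> 0 < q < 1 ->
  kl q p = q * ln (q * (1 - p) / (p * (1 - q))) - ln ((1 - p) / (1 - q)).
Proof.
move=> /andP[p0 p1] /andP[q0 q1].
have p1' : 0 < 1 - p by lra.
have q1' : 0 < 1 - q by lra.
have -> : q * (1 - p) / (p * (1 - q)) = (q / p) * ((1 - p) / (1 - q)).
  by field; apply/andP; split; lra.
have lE : ln ((1 - q) / (1 - p)) = - ln ((1 - p) / (1 - q)).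
  by rewrite -lnV ?posrE ?divr_gt0// invf_div.
by rewrite /kl lE (lnM (x := q / p)) ?posrE ?divr_gt0//; ring.
Qed.

(** Since ln s >= 0, replacing N by g/q only weakens the bound, and the exponent is then counted per
    success. In [tail_lt_kl] both signs are reversed. *)
Lemma tail_ge_kl {R : realType} (p q : R) (N g : nat) :
  0 < p -> p < q -> q < 1 -> N%:R * q <= g%:R ->
  tail_ge N p g <= expR (- (g%:R * (kl q p / q))).
Proof.
move=> p0 pq q1 h.
have q0 : 0 < q by lra.
have p1' : 0 < 1 - p by lra.
have q1' : 0 < 1 - q by lra.
pose x := q * (1 - p) / (p * (1 - q)); pose s := (1 - p) / (1 - q).
apply: le_trans (@tail_ge_chernoff R p x s N g _ _ _) _.
- lra.
- by rewrite /x ler_pdivlMr ?mulr_gt0//; nra.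
- by rewrite /s /x; field; apply/andP; split; lra.
rewrite ler_expR klE; [|lra|lra].
rewrite -/x -/s mulrA; set l := ln x; set k := ln s.
have k0 : 0 <= k by apply: ln_ge0; rewrite /s ler_pdivlMr; lra.
have -> : g%:R * (q * l - k) / q = g%:R * l - (g%:R / q) * k by field; lra.
have : N%:R * k <= g%:R / q * k by rewrite ler_wpM2r// ler_pdivlMr.
lra.
Qed.

Lemma tail_lt_kl {R : realType} (p q : R) (N g : nat) :
  0 < q -> q < p -> p < 1 -> g%:R <= N.+1%:R * q ->
  tail_lt N p g <= expR (- (g%:R * (kl q p / q))).
Proof.
move=> q0 qp p1 h.
have p0 : 0 < p by lra.
have p1' : 0 < 1 - p by lra.
have q1' : 0 < 1 - q by lra.
pose x := q * (1 - p) / (p * (1 - q)); pose s := (1 - p) / (1 - q).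
apply: le_trans (@tail_lt_chernoff R p x s N g _ _ _) _.
- lra.
- by rewrite /x divr_gt0 ?mulr_gt0//= ler_pdivrMr ?mulr_gt0//; nra.
- by rewrite /s /x; field; apply/andP; split; lra.
rewrite ler_expR klE; [|lra|lra].
rewrite -/x -/s mulrA; set l := ln x; set k := ln s.
have k0 : k <= 0 by apply: ln_le0; rewrite /s ler_pdivrMr; lra.
have -> : g%:R * (q * l - k) / q = g%:R * l - (g%:R / q) * k by field; lra.
have : N.+1%:R * k <= g%:R / q * k by rewrite ler_wnM2r// ler_pdivrMr.
lra.
Qed.

(** Here y = p (1 + e/3) in [kl_ge]. The sign of e is free, so both tails are covered. *)
Lemma kl_relative_ge {R : realType} (p e : R) : 0 < p < 1 -> -1 < e < 1 ->
  (1 + e) * p < 1 ->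
  e ^+ 2 / (2 * ((1 + e) * (1 + e / 3) * (1 - p * (1 + e / 3)))) <=
  kl ((1 + e) * p) p / ((1 + e) * p).
Proof.
move=> /andP[p0 p1] /andP[e0 e1] q1; have q0 : 0 < (1 + e) * p by rewrite mulr_gt0; lra.
have y1 : 0 < 1 - p * (1 + e / 3) by nra.
have := @kl_ge R p ((1 + e) * p) (p * (1 + e / 3)) ltac:(lra) ltac:(lra) ltac:(lra).
rewrite ler_pdivlMr//; apply: le_trans.
rewrite le_eqVlt; apply/orP; left; apply/eqP; field.
by repeat (apply/andP; split); lra.
Qed.

(** * The constants m and z of part (II) *)

Lemma ln2_ge_half {R : realType} : 2^-1 <= ln 2 :> R.
Proof. by have := @subr1_ge_lnV R 2 ltac:(lra); lra. Qed.

(** With L = ln (1/delta), this is the numerator of m - z - m z over the denominator (3 + e)^2 (L +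
    ln 2) e^2. *)
Definition log_quad {R : realType} (e L : R) : R :=
  2 * (9 - 6 * e - 2 * e ^+ 2) * L ^+ 2
  - e * (3 * e ^+ 2 * (4 + e) + 4 * (3 + e) * ln 2) * L
  - 3 * e ^+ 2 * (1 + e) * (3 + e) * ln 2.

(* delta_bound is the exponential of minus the positive root of log_quad e. *)
Lemma delta_bound_log_quad {R : realType} (e delta : R) : 0 < e < 1 ->
  0 < delta < delta_bound e ->
  0 < ln (1 / delta) /\ 0 < log_quad e (ln (1 / delta)).
Proof.
move=> /andP[e0 e1] /andP[d0 dlt].
have l2 := @ln2_ge_half R.
rewrite div1r lnV ?posrE//.
move: dlt; rewrite -[X in X < _]lnK ?posrE// ltr_expR.
set D := 9 - _ - _.
have D0 : 0 < D by rewrite /D; nra.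
set L := ln delta.
set b := (3 * e ^+ 2 * (4 + e) + _) / (4 * D).
set c := (_ / (2 * D) : R).
have b0 : 0 < b by rewrite /b divr_gt0 ?mulr_gt0//; nra.
have c0 : 0 < c by rewrite /c divr_gt0// ?mulr_gt0//; nra.
rewrite (_ : (3 * e ^+ 3 * (4 + e) + _) / _ = e * b); last first.
  by rewrite /b; field; lra.
have s0 : 0 <= Num.sqrt (b ^+ 2 + c) by exact: sqrtr_ge0.
have sE : Num.sqrt (b ^+ 2 + c) ^+ 2 = b ^+ 2 + c by rewrite sqr_sqrtr//; nra.
move: s0 sE; set s := Num.sqrt _ => s0 sE h.
have L0 : e * (b + s) < - L by lra.
split; first by apply: le_lt_trans L0; nra.
have h2 : (e * s) ^+ 2 < (- L - e * b) ^+ 2.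
  by rewrite ltrXn2r//; nra.
(* Completing the square; here [L] is ln delta, so [- L] is ln (1/delta). *)
have -> : log_quad e (- L) = 2 * D * ((- L - e * b) ^+ 2 - (e * s) ^+ 2).
  rewrite !exprMn sE /b /c /log_quad -/D; field; lra.
by rewrite mulr_gt0//; lra.
Qed.

Lemma z_bounds {R : realType} (e L m z : R) : 0 < e < 1 -> 0 < L ->
  0 < log_quad e L -> m = 2 / e ^+ 2 * L ->
  z = 1 + 2 * e / (3 + e) - 9 / (3 + e) ^+ 2 * (L / (L + ln 2)) ->
  0 < m /\ 0 < z < 1 /\ 0 < m - z - m * z /\ 1 - e <= m * e.
Proof.
move=> /andP[e0 e1] L0 Q0 mE zE; have l2 := @ln2_ge_half R.
have L2 : 0 < L + ln 2 by lra.
have e20 : 0 < e ^+ 2 by nra.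
have m0 : 0 < m by rewrite mE mulr_gt0// divr_gt0.
have r1 : L / (L + ln 2) < 1 by rewrite ltr_pdivrMr//; lra.
have r0 : 0 < L / (L + ln 2) by rewrite divr_gt0.
have e32 : 0 < (3 + e) ^+ 2 by nra.
have z0 : 0 < z.
  have -> : z = (9 * (1 - L / (L + ln 2)) + 12 * e + 3 * e ^+ 2) / (3 + e) ^+ 2.
    by rewrite zE; field; apply/andP; split; lra.
  by rewrite divr_gt0//; nra.
have w0 : 0 < m - z - m * z.
  have -> : m - z - m * z = log_quad e L / ((3 + e) ^+ 2 * (L + ln 2) * e ^+ 2).
    rewrite zE mE /log_quad; field; by repeat (apply/andP; split); lra.
  by rewrite divr_gt0 ?mulr_gt0//; lra.
have z1 : z < 1 by nra.
split => //; split; first by rewrite z0 z1.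
(* If m e < 1 - e, then 1 - z <= m e^2 gives z > 1 - e + e^2, whereas z < m (1 - z) <= (m e)^2 < (1
   - e)^2: a contradiction. *)
split => //; rewrite leNgt; apply/negP => hm.
have Lm : L = m * e ^+ 2 / 2 by rewrite mE; field; lra.
have r2 : L / (L + ln 2) <= 2 * L by rewrite ler_pdivrMr//; nra.
have zr : 1 - z <= L / (L + ln 2).
  have -> : 1 - z = 9 * (L / (L + ln 2)) / (3 + e) ^+ 2 - 2 * e / (3 + e).
    by rewrite zE; field; apply/andP; split; lra.
  have : 9 * (L / (L + ln 2)) / (3 + e) ^+ 2 <= L / (L + ln 2).
    by rewrite ler_pdivrMr//; nra.
  have : 0 <= 2 * e / (3 + e) by rewrite divr_ge0//; lra.
  lra.
have ze : 1 - z <= m * e ^+ 2 by lra.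
nra.
Qed.

(** The left side decreases in p, and z is exactly the value of (1 + e) p at which it equals r. *)
Lemma upper_threshold {R : realType} (e r z p : R) : 0 < e < 1 ->
  z = 1 + 2 * e / (3 + e) - 9 / (3 + e) ^+ 2 * r -> z < (1 + e) * p ->
  (1 + e) * (1 + e / 3) * (1 - p * (1 + e / 3)) < r.
Proof.
move=> /andP[e0 e1] zE h.
have e32 : 0 < (3 + e) ^+ 2 by nra.
have : (3 + e) ^+ 2 * z < (3 + e) ^+ 2 * ((1 + e) * p) by rewrite ltr_pM2l.
rewrite (_ : (3 + e) ^+ 2 * z = 9 + 12 * e + 3 * e ^+ 2 - 9 * r).
  by lra.
by rewrite zE; field; lra.
Qed.

Lemma lower_threshold {R : realType} (e r z p : R) : 0 < e < 1 -> 0 <= r ->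
  z = 1 + 2 * e / (3 + e) - 9 / (3 + e) ^+ 2 * r -> z < p ->
  (1 - e) * (1 - e / 3) * (1 - p * (1 - e / 3)) <= r.
Proof.
move=> /andP[e0 e1] r0 zE h.
have e32 : 0 < (3 + e) ^+ 2 by nra.
have k0 : 0 <= (1 - e) * (1 - e / 3) ^+ 2 by rewrite mulr_ge0 ?sqr_ge0//; lra.
(* By monotonicity p is replaced by z. The result, times (3 + e)^2, is affine in r: [h1] bounds its
   constant term by 0 and [h2] its slope by (3 + e)^2. *)
apply: (@le_trans _ _ ((1 - e) * (1 - e / 3) - (1 - e) * (1 - e / 3) ^+ 2 * z)).
  by nra.
rewrite -(ler_pM2l e32).
have -> : (3 + e) ^+ 2 * ((1 - e) * (1 - e / 3) - (1 - e) * (1 - e / 3) ^+ 2 * z)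
  = (1 - e) * ((1 - e / 3) * (3 + e) ^+ 2
      - (1 - e / 3) ^+ 2 * (9 + 12 * e + 3 * e ^+ 2 - 9 * r)).
  by rewrite zE; field; lra.
have h1 : (1 - e) * ((1 - e / 3) * (3 + e) ^+ 2
      - (1 - e / 3) ^+ 2 * (9 + 12 * e + 3 * e ^+ 2)) <= 0.
  have -> : (1 - e) * ((1 - e / 3) * (3 + e) ^+ 2
      - (1 - e / 3) ^+ 2 * (9 + 12 * e + 3 * e ^+ 2)) =
      - ((1 - e / 3) * (3 + e) * e * (1 - e) ^+ 2) by field.
  rewrite oppr_le0 mulr_ge0 ?sqr_ge0//.
  by rewrite !mulr_ge0//; lra.
have h2 : (1 - e) * (1 - e / 3) ^+ 2 * 9 <= (3 + e) ^+ 2 by nra.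
have h3 : (1 - e) * (1 - e / 3) ^+ 2 * 9 * r <= (3 + e) ^+ 2 * r by rewrite ler_wpM2r.
lra.
Qed.

(** * Bounds of part (II) *)

(** The tilted coin has mean exactly g/N, so the remaining tail is the event of being at least the
    mean. *)
Lemma tail_ge_tilt_mean {R : realType} (p e : R) (N g : nat) :
  0 < p < 1 -> 0 < e -> (0 < g)%N -> (g < N)%N -> N%:R * ((1 + e) * p) <= g%:R ->
  tail_ge N p g <= expR (- (g%:R * rate e)) * tail_ge N (g%:R / N%:R) g.
Proof.
move=> /andP[p0 p1] e0 g0 gN h.
have g0' : 0 < g%:R :> R by rewrite ltr0n.
have N0' : 0 < N%:R :> R by rewrite ltr0n (leq_ltn_trans _ gN).
have gN' : g%:R < N%:R :> R by rewrite ltr_nat.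
set q : R := g%:R / N%:R.
have Nq : N%:R * q = g%:R by rewrite /q mulrC divfK// gt_eqF.
have q0 : 0 < q by rewrite divr_gt0.
have q1 : q < 1 by rewrite /q ltr_pdivrMr// mul1r.
have pq : (1 + e) * p <= q by rewrite /q ler_pdivlMr// mulrC.
have p1' : 0 < 1 - p by lra.
have q1' : 0 < 1 - q by lra.
pose s := (1 - p) / (1 - q); pose x := q / p * s.
have s1 : 1 <= s by rewrite /s ler_pdivlMr//; nra.
have a0 : 1 + e <= q / p by rewrite ler_pdivlMr.
have sE : s = 1 - p + p * x by rewrite /x /s; field; apply/andP; split; lra.
have qE : q = p * x / s.
  by rewrite /x; field; apply/andP; split; lra.
apply: le_trans (@tail_ge_tilt R p x q s N g _ _ sE qE) _; [lra|rewrite /x; nra|].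
rewrite ler_wpM2r//.
  by rewrite /tail_ge sumr_ge0// => b _; apply: bern_word_ge0; lra.
rewrite ler_expR /x lnM ?posrE ?divr_gt0//.
(* The exponent is (N - g) ln s - g ln (q/p). Linearising ln s leaves g (1 - 1/a - ln a) with a =
   q/p. *)
have ls : ln s <= s - 1 by apply: ln_le_sub1; lra.
have h1 : (N%:R - g%:R) * ln s <= (N%:R - g%:R) * (s - 1).
  by rewrite ler_wpM2l//; lra.
have h2 : (N%:R - g%:R) * (s - 1) = g%:R - N%:R * p.
  by rewrite -Nq /s; field; lra.
set a := q / p in a0 *.
have h3 : N%:R * p = g%:R * a^-1 by rewrite -Nq /a; field; apply/andP; split; lra.
clearbody a.
have e1 : 0 < 1 + e by lra.
(* [h4] to [h6] compare ln a + 1/a with its value at 1 + e <= a, which yields [rate e]. *)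
have h4 := @subr1_ge_lnV R (a / (1 + e)) ltac:(rewrite divr_gt0//; lra).
rewrite ln_div ?posrE ?invf_div in h4; [|lra..].
have h5 : (1 + e)^-1 * (1 - (1 + e) / a) <= 1 - (1 + e) / a.
  apply: ler_piMl; last by rewrite invf_le1; lra.
  by rewrite subr_ge0 ler_pdivrMr; lra.
have h6 : (1 + e)^-1 * (1 - (1 + e) / a) = (1 + e)^-1 - a^-1.
  by field; apply/andP; split; lra.
have h7 : e / (1 + e) = 1 - (1 + e)^-1 by field; lra.
have h8 : g%:R * (1 - a^-1 - ln a) <= g%:R * (- rate e).
  by rewrite ler_wpM2l// /rate h7; lra.
lra.
Qed.

Lemma tail_lt_tilt_mean {R : realType} (p e : R) (N g : nat) :
  0 < p < 1 -> 0 < e < 1 -> g%:R <= N.+1%:R * ((1 - e) * p) ->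
  tail_lt N p g <= expR (- (g%:R * rate e)) * tail_lt N (p * (1 - e) / (1 - p * e)) g.
Proof.
move=> p01 e01 h.
have s0 : 0 < 1 - p * e by nra.
have q01 : 0 <= p * (1 - e) / (1 - p * e) <= 1.
  by rewrite divr_ge0 ?ler_pdivrMr ?mul1r; nra.
apply: le_trans (@tail_lt_tilt R p (1 - e) _ (1 - p * e) N g p01 _ _ erefl) _; [lra|lra|].
rewrite ler_wpM2r ?ler_expR ?lower_exponent_le//.
by rewrite /tail_lt sumr_ge0// => b _; exact: bern_word_ge0.
Qed.

Lemma divr_sqrt_le {R : realType} (C V K : R) : 0 <= C -> 0 < V -> V^-1 <= K ->
  C / Num.sqrt V <= C * Num.sqrt K.
Proof.
move=> C0 V0 VK; rewrite ler_wpM2l// -sqrtrV; last exact: ltW.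
by rewrite ler_wsqrtr.
Qed.

Lemma tail_ge_berry_esseen {R : realType} (C K p e : R) (N g : nat) :
  berry_esseen_constant C -> 0 < p < 1 -> 0 < e -> (0 < g)%N -> (g < N)%N ->
  N%:R * ((1 + e) * p) <= g%:R -> g%:R^-1 + (N%:R - g%:R)^-1 <= K ->
  tail_ge N p g <= expR (- (g%:R * rate e)) * (2^-1 + C * Num.sqrt K).
Proof.
move=> BE p01 e0 g0 gN h hK.
apply: le_trans (tail_ge_tilt_mean p e N g p01 e0 g0 gN h) _.
rewrite ler_wpM2l ?expR_ge0//.
have g0' : 0 < g%:R :> R by rewrite ltr0n.
have N0' : 0 < N%:R :> R by rewrite ltr0n (leq_ltn_trans _ gN).
have gN' : g%:R < N%:R :> R by rewrite ltr_nat.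
set q : R := g%:R / N%:R.
have Nq : N%:R * q = g%:R by rewrite /q mulrC divfK// gt_eqF.
have q01 : 0 < q < 1 by rewrite /q divr_gt0//= ltr_pdivrMr// mul1r.
have [C0 le] := berry_esseen_words C q (-1) N BE q01 (leq_ltn_trans (leq0n _) gN) ltac:(ring).
apply: (@le_trans _ _ (2^-1 + C / Num.sqrt (N%:R * (q * (1 - q))))).
  apply: le_trans le; rewrite le_eqVlt; apply/orP; left; apply/eqP; apply: eq_bigl => b.
  by rewrite Nq mulN1r oppr_le0 subr_ge0 ler_nat.
have qq0 : 0 < q * (1 - q) by apply: mulr_gt0; lra.
rewrite lerD2l; apply: divr_sqrt_le => //; first exact: mulr_gt0.
(* The variance is g (N - g) / N, with reciprocal 1/g + 1/(N - g). *)
apply: le_trans hK; rewrite le_eqVlt; apply/orP; left; apply/eqP.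
by rewrite mulrA Nq /q; field; repeat (apply/andP; split); lra.
Qed.

Lemma tail_lt_berry_esseen {R : realType} (C K p e : R) (N g : nat) :
  berry_esseen_constant C -> 0 < p < 1 -> 0 < e < 1 -> (0 < N)%N ->
  g%:R <= N.+1%:R * ((1 - e) * p) -> 1 - e <= g%:R * e ->
  (g%:R * (1 - p))^-1 <= K ->
  tail_lt N p g <= expR (- (g%:R * rate e)) * (2^-1 + C * Num.sqrt K).
Proof.
move=> BE p01 e01 N0 h he hK.
apply: le_trans (tail_lt_tilt_mean p e N g p01 e01 h) _.
rewrite ler_wpM2l ?expR_ge0//.
have [/ltW p0 p1] := andP p01; have [e0 e1] := andP e01.
have s0 : 0 < 1 - p * e by nra.
set q := p * (1 - e) / (1 - p * e).
have q01 : 0 < q < 1.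
  by rewrite /q divr_gt0 ?ltr_pdivrMr ?mul1r//; nra.
have qp : q <= p by rewrite /q ler_pdivrMr// ler_wpM2l//; nra.
(* The slack 1 - e <= g e pays for passing from [N.+1] to [N], so the tail lies below the tilted
   mean. *)
have Nq : g%:R <= N%:R * q.
  have hp : p * (1 - e) <= p * (g%:R * e) by rewrite ler_wpM2l.
  by rewrite /q [leRHS]mulrA ler_pdivlMr//; move: h; rewrite -natr1; lra.
have [C0 le] := berry_esseen_words C q 1 N BE q01 N0 ltac:(ring).
apply: (@le_trans _ _ (2^-1 + C / Num.sqrt (N%:R * (q * (1 - q))))).
  apply: le_trans le; rewrite /tail_lt [leRHS]big_mkcond [leLHS]big_mkcond/=; apply: ler_sum => b _.
  case: ifPn => [gb|_]; last by case: ifP => // _; apply: bern_word_ge0; lra.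
  rewrite ifT// mul1r subr_le0 (le_trans _ Nq)// ler_nat; exact: ltnW.
have g0 : 0 < g%:R :> R by rewrite ltr0n lt0n; apply/eqP => gE; move: he; rewrite gE; lra.
have Nq0 : 0 < N%:R * q by exact: lt_le_trans Nq.
rewrite lerD2l; apply: divr_sqrt_le => //.
  by rewrite mulrA; apply: mulr_gt0 => //; lra.
(* The variance N q (1 - q) is at least g (1 - p), as N q >= g and q <= p. *)
apply: le_trans hK; rewrite mulrA lef_pV2 ?posrE.
- by apply: ler_pM => //; lra.
- by apply: mulr_gt0 => //; lra.
- by apply: mulr_gt0 => //; lra.
Qed.

Lemma expR_rate_lt {R : realType} (e delta c : R) (g : nat) :
  0 < e -> 0 < delta -> 0 < c -> coefA e * ln (c / delta) < g%:R ->
  expR (- (g%:R * rate e)) * c < delta.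
Proof.
move=> e0 d0 c0; have r0 := @rate_gt0 R e e0.
rewrite coefAE// mulrC ltr_pdivrMr// ln_div ?posrE// => h.
rewrite -ltr_pdivlMr// -[ltRHS]lnK ?posrE ?divr_gt0// ltr_expR ln_div ?posrE//.
lra.
Qed.

Lemma good_event_gt {R : realType} {d : measure_display}
    {T : measurableType d} {P : probability T R} (X : nat -> {RV P >-> R})
    (g N1 N2 : nat) (p e delta : R) :
  iid_seq X -> bernoulli_rv p (X 0%N) -> (0 < g)%N -> 0 < p < 1 -> 0 < e ->
  g%:R < N1.+1%:R * ((1 + e) * p) -> N2%:R * ((1 - e) * p) < g%:R ->
  tail_ge N1 p g < delta / 2 -> tail_lt N2 p g <= delta / 2 ->
  ((1 - delta)%:E < P (good_event X g p e))%E.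
Proof.
move=> iidX bX g0 p01 e0 h1 h2 t1 t2.
apply: lt_le_trans (good_event_ge X g N1 N2 p e iidX bX g0 p01 e0 h1 h2).
by rewrite lte_fin; lra.
Qed.

(** Above z the exponent per success is at least e^2/(2r) with r = L/(L + ln 2). As g exceeds
    2L/e^2, the total exceeds L/r = L + ln 2, which means a bound of delta/2. *)
Lemma tail_ge_large_mean {R : realType} (p e z L : R) (N g : nat) :
  0 < p < 1 -> 0 < e < 1 -> 0 < L -> 2 / e ^+ 2 * L < g%:R -> z < 1 ->
  z = 1 + 2 * e / (3 + e) - 9 / (3 + e) ^+ 2 * (L / (L + ln 2)) ->
  z < (1 + e) * p -> N%:R * ((1 + e) * p) <= g%:R ->
  tail_ge N p g < expR (- (L + ln 2)).
Proof.
move=> p01 e01 L0 gm z1 zE zp Ng.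
have [p0 p1] := andP p01; have [e0 e1] := andP e01.
have l2 := @ln2_ge_half R.
have hr := upper_threshold e _ z p e01 zE zp.
set r := L / (L + ln 2) in zE hr.
have r0 : 0 < r by rewrite divr_gt0//; lra.
have Lr : L + ln 2 = L / r by rewrite /r; field; apply/andP; split; lra.
have g0 : 0 < g%:R :> R by apply: lt_trans gm; rewrite mulr_gt0// divr_gt0//; nra.
have L2g : L + ln 2 < g%:R * (e ^+ 2 / (2 * r)).
  have -> : L + ln 2 = 2 / e ^+ 2 * L * (e ^+ 2 / (2 * r)).
    by rewrite Lr; field; apply/andP; split; lra.
  by rewrite ltr_pM2r// divr_gt0//; nra.
have [q1|q1] := ltP ((1 + e) * p) 1.
  apply: le_lt_trans (@tail_ge_kl R p ((1 + e) * p) N g _ _ _ Ng) _ => //; first nra.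
  rewrite ltr_expR ltrN2; apply: lt_le_trans L2g _.
  rewrite ler_wpM2l//; have e11 : -1 < e < 1 by lra.
  apply: le_trans (kl_relative_ge p e p01 e11 q1).
  have y1 : 0 < 1 - p * (1 + e / 3) by nra.
  have hh : 0 < (1 + e) * (1 + e / 3) * (1 - p * (1 + e / 3)).
    by rewrite !mulr_gt0//; lra.
  apply: ler_wpM2l; first exact: sqr_ge0.
  by rewrite lef_pV2 ?posrE; lra.
(* If (1 + e) p >= 1, then N <= g. For N < g the tail is empty; N = g forces (1 + e) p = 1 and
   leaves the all-heads probability p^g. *)
have Ng' : (N <= g)%N.
  by rewrite -(ler_nat R); apply: le_trans Ng; rewrite ler_peMr.
have [NE|NE] := eqVneq N g; last first.
  by rewrite tail_ge_out ?expR_gt0// ltn_neqAle NE.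
have qE : (1 + e) * p = 1.
  apply/eqP; rewrite eq_le q1 andbT.
  by move: Ng; rewrite NE -[leRHS]mulr1 ler_pM2l.
rewrite NE; apply: le_lt_trans (tail_ge_all g p _) _; first lra.
rewrite -[p]lnK ?posrE// -expRM_natl ltr_expR.
have pE : p = (1 + e)^-1.
  by apply: (@mulfI _ (1 + e)); rewrite ?qE ?divff//; lra.
rewrite pE lnV ?posrE; last lra.
rewrite mulrN ltrN2; apply: lt_le_trans L2g _; rewrite ler_wpM2l//.
(* At p = 1/(1 + e) the threshold inequality reads r > 2e(3 + e)/9, so e^2/(2r) is below 9e/(4(3 +
   e)). *)
apply: le_trans (ln1D_ge e e0).
move: hr; rewrite pE.
have -> : (1 + e) * (1 + e / 3) * (1 - (1 + e)^-1 * (1 + e / 3)) =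
   2 * e * (3 + e) / 9 by field; lra.
move=> hr; rewrite ler_pdivrMr; last lra.
rewrite mulrAC ler_pdivlMr; last lra.
nra.
Qed.

Lemma tail_lt_large_mean {R : realType} (p e z L : R) (N g : nat) :
  0 < p < 1 -> 0 < e < 1 -> 0 < L -> 2 / e ^+ 2 * L < g%:R ->
  z = 1 + 2 * e / (3 + e) - 9 / (3 + e) ^+ 2 * (L / (L + ln 2)) ->
  z < p -> g%:R <= N.+1%:R * ((1 - e) * p) ->
  tail_lt N p g < expR (- (L + ln 2)).
Proof.
move=> p01 e01 L0 gm zE zp Ng.
have [p0 p1] := andP p01; have [e0 e1] := andP e01.
have l2 := @ln2_ge_half R.
have r0 : 0 < L / (L + ln 2) by rewrite divr_gt0//; lra.
have hr := lower_threshold e _ z p e01 (ltW r0) zE zp.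
set r := L / (L + ln 2) in r0 zE hr.
have Lr : L + ln 2 = L / r by rewrite /r; field; apply/andP; split; lra.
have g0 : 0 < g%:R :> R by apply: lt_trans gm; rewrite mulr_gt0// divr_gt0//; nra.
have L2g : L + ln 2 < g%:R * (e ^+ 2 / (2 * r)).
  have -> : L + ln 2 = 2 / e ^+ 2 * L * (e ^+ 2 / (2 * r)).
    by rewrite Lr; field; apply/andP; split; lra.
  by rewrite ltr_pM2r// divr_gt0//; nra.
apply: le_lt_trans (@tail_lt_kl R p ((1 - e) * p) N g _ _ _ Ng) _ => //.
- by rewrite mulr_gt0//; lra.
- nra.
rewrite ltr_expR ltrN2; apply: lt_le_trans L2g _.
rewrite ler_wpM2l//.
have e11 : -1 < - e < 1 by lra.
apply: le_trans (kl_relative_ge p (- e) p01 e11 _); last nra.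
rewrite sqrrN mulNr.
have y1 : 0 < 1 - p * (1 - e / 3) by nra.
have hh : 0 < (1 - e) * (1 - e / 3) * (1 - p * (1 - e / 3)).
  by rewrite !mulr_gt0//; lra.
apply: ler_wpM2l; first exact: sqr_ge0.
  by rewrite lef_pV2 ?posrE; lra.
Qed.

(** * Cut-offs for the stopping time and proof of both claims *)

Theorem theorem5 (R : realType) (gamma : nat) (hgamma : (0 < gamma)%N) :
  (* (I) *)
  (forall eps delta : R, 0 < eps -> 0 < delta < 1 ->
     gamma%:R > coefA eps * ln (2 / delta) ->
     forall (p : R), 0 < p < 1 ->
     forall (d : measure_display) (T : measurableType d) (P : probability T R)
            (X : nat -> {RV P >-> R}),
       iid_seq X -> bernoulli_rv p (X 0%N) ->
       (P (good_event X gamma p eps) > (1 - delta)%:E)%E) /\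
  (* (II) *)
  (forall C : R, berry_esseen_constant C ->
   forall eps delta : R, 0 < eps < 1 -> 0 < delta < delta_bound eps ->
     gamma%:R > coefA eps * ln ((1 + zeta C eps delta) / delta) ->
     forall (p : R), 0 < p < 1 ->
     forall (d : measure_display) (T : measurableType d) (P : probability T R)
            (X : nat -> {RV P >-> R}),
       iid_seq X -> bernoulli_rv p (X 0%N) ->
       (P (good_event X gamma p eps) > (1 - delta)%:E)%E).
Proof.
have g0 : 0 < gamma%:R :> R by rewrite ltr0n.
split.
  move=> e delta e0 /andP[d0 d1] hg p p01 d T P X iidX bX.
  have [p0 p1] := andP p01.
  have up0 : 0 < (1 + e) * p by rewrite mulr_gt0//; lra.
  (* Stopping after [N1], the last index with N1 (1 + e) p <= gamma, puts the estimate below (1 + e)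
     p. *)
  have [N1 []] := @floor_nat R (gamma%:R / ((1 + e) * p))
    ltac:(by rewrite divr_ge0 ?ltW).
  rewrite ler_pdivlMr// ltr_pdivrMr// => h1 h1'.
  have hd : expR (- (gamma%:R * rate e)) < delta / 2.
    by rewrite ltr_pdivlMr//; apply: expR_rate_lt.
  have tU : tail_ge N1 p gamma < delta / 2.
    by apply: le_lt_trans hd; exact: tail_ge_rate.
  have [e1|e1] := ltP e 1.
    have lp0 : 0 < (1 - e) * p by rewrite mulr_gt0//; lra.
    (* Stopping by [N2], the last index with N2 (1 - e) p < gamma, puts the estimate above (1 - e)
       p. *)
    have [N2 []] := @ceil_pred_nat R (gamma%:R / ((1 - e) * p))
      ltac:(by rewrite divr_gt0).
    rewrite ltr_pdivlMr// ler_pdivrMr// => h2 h2'.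
    apply: (good_event_gt X gamma N1 N2) => //.
    by apply: le_trans (ltW hd); apply: tail_lt_rate => //; rewrite e0 e1.
  have [N2 hN2] := @tail_lt_small R p (delta / 2) gamma p01 ltac:(lra).
  apply: (good_event_gt X gamma N1 N2) => //.
  by apply: le_lt_trans g0; rewrite mulr_ge0_le0// mulr_le0_ge0//; lra.
move=> C BE e delta e01 hd hg p p01 d T P X iidX bX.
have [p0 p1] := andP p01; have [e0 e1] := andP e01.
have d0 : 0 < delta by case/andP: hd.
have l2 := @ln2_ge_half R.
have [L0 Q0] := delta_bound_log_quad e delta e01 hd.
have L2E : ln (2 / delta) = ln (1 / delta) + ln 2.
  by rewrite -lnM ?posrE ?divr_gt0//; congr ln; field; lra.
move: hg; rewrite /zeta L2E.
set L := ln (1 / delta) in L0 Q0 L2E *.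
set m := 2 / e ^+ 2 * L; set z := 1 + _ - _; set K := 1 / m + _ => hg.
have KE : K = m^-1 + z / (m - z - m * z) by rewrite /K div1r.
have [m0 [z01 [w0 me]]] := z_bounds e L m z e01 L0 Q0 erefl erefl.
have [z0 z1] := andP z01.
have [C0 _] := berry_esseen_words C 2^-1 1 1 BE ltac:(lra) isT ltac:(ring).
have zeta0 : 0 <= 2 * C * Num.sqrt K by rewrite !mulr_ge0// sqrtr_ge0.
(* From [coefA e] = 1 / [rate e] >= 2/e^2 and zeta >= 0. *)
have gm : m < gamma%:R.
  apply: le_lt_trans hg; rewrite coefAE//.
  have r0 := @rate_gt0 R e e0; have rle := @rate_le R e e0.
  have L2 : L <= ln ((1 + 2 * C * Num.sqrt K) / delta).
    by rewrite ler_ln ?posrE ?divr_gt0// ?ler_wpM2r ?invr_ge0; lra.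
  rewrite [leRHS]mulrC ler_pdivlMr//; apply: le_trans L2.
  have -> : m * rate e = L * (rate e / (e ^+ 2 / 2)) by rewrite /m; field; lra.
  by rewrite ler_piMr ?(ltW L0)// ler_pdivrMr ?mul1r// divr_gt0//; nra.
(* With zeta = 2 C sqrt K, half of 1 + zeta is the Berry-Esseen factor 1/2 + C sqrt K. *)
have half : expR (- (gamma%:R * rate e)) * (2^-1 + C * Num.sqrt K) < delta / 2.
  have : expR (- (gamma%:R * rate e)) * (1 + 2 * C * Num.sqrt K) < delta.
    by apply: expR_rate_lt => //; lra.
  lra.
have d2 : expR (- (L + ln 2)) = delta / 2.
  by rewrite -L2E -lnV ?posrE ?divr_gt0// invf_div lnK// posrE divr_gt0.
have up0 : 0 < (1 + e) * p by rewrite mulr_gt0//; lra.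
have lp0 : 0 < (1 - e) * p by rewrite mulr_gt0//; lra.
have [N1 []] := @floor_nat R (gamma%:R / ((1 + e) * p))
  ltac:(by rewrite divr_ge0 ?ltW).
rewrite ler_pdivlMr// ltr_pdivrMr// => h1 h1'.
have [N2 []] := @ceil_pred_nat R (gamma%:R / ((1 - e) * p))
  ltac:(by rewrite divr_gt0).
rewrite ltr_pdivlMr// ler_pdivrMr// => h2 h2'.
apply: (good_event_gt X gamma N1 N2) => //.
  have [zp|pz] := ltP z ((1 + e) * p).
    rewrite -d2; exact: (tail_ge_large_mean p e z L).
  have hN : gamma%:R < N1.+1%:R * z.
    by apply: lt_le_trans h1' _; rewrite ler_wpM2l.
  (* As (N1 + 1) z > gamma, z (N1 - gamma) exceeds gamma (1 - z) - z, and gamma > m. Hence 1/(N1 -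
     gamma) is at most the second term of [K]. *)
  have wN : m - z - m * z <= z * (N1%:R - gamma%:R).
    by move: hN; rewrite -natr1; nra.
  have N1g : gamma%:R < N1%:R :> R.
    by rewrite -subr_gt0 -(pmulr_rgt0 _ z0); exact: lt_le_trans wN.
  apply: le_lt_trans half; apply: tail_ge_berry_esseen => //.
    by rewrite -(ltr_nat R).
  rewrite KE lerD ?lef_pV2 ?posrE ?(ltW gm)//.
  rewrite ler_pdivlMr// -[leRHS]mulr1 mulrC ler_pdivrMr ?mulr1//.
  by rewrite subr_gt0.
have [zp|pz] := ltP z p.
  by rewrite -d2; apply: ltW; exact: (tail_lt_large_mean p e z L).
apply: le_trans (ltW half); apply: tail_lt_berry_esseen => //.
(* N2 = 0 would give gamma <= (1 - e) p < 1. *)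
- case: N2 h2' {h2} => // h2'; exfalso.
  have : (1 : R) <= gamma%:R by rewrite ler1n.
  by move: h2'; rewrite mul1r; nra.
- by apply: le_trans me _; rewrite ler_wpM2r// ltW.
(* Here gamma (1 - p) >= m (1 - z), whose reciprocal is 1/m + z/(m (1 - z)); this is at most [K]
   because m (1 - z) >= m - z - m z. *)
- apply: (@le_trans _ _ (m * (1 - z))^-1).
    rewrite lef_pV2 ?posrE; [|by rewrite mulr_gt0//; lra|by rewrite mulr_gt0//; lra].
    by apply: ler_pM => //; lra.
  have -> : (m * (1 - z))^-1 = m^-1 + z / (m * (1 - z)).
    by field; apply/andP; split; lra.
  rewrite KE lerD2l ler_wpM2l ?(ltW z0)// lef_pV2 ?posrE; [lra|nra|lra].
Qed.
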